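(* Let $m\in\mathbb{N}$, let $a_1,\dots,a_m\in\mathbb{C}$ with $a_1\neq 0$, let $P(s)=\sum_{k=1}^{m} a_k k^{-s}$, and let $r\in\mathbb{R}$. For $n\in\mathbb{N}$ define $d_{n,r}\ge 0$ by $$ d_{n,r}^2=\inf_{b_1,\ldots,b_n\in \mathbb{C}}\int_0^\infty \left|\mathbf{1}_{(0,1)}(x)-\sum_{k=1}^n b_k\, \kappa_r\left(\frac{1}{kx}\right)\right|^2 dx . $$ Then $P(s)$ does not vanish in the half-plane $\Re(s)>r$ if and only if $\lim_{n\to\infty} d_{n,r}=0$.
   Context: For the Dirichlet polynomial $P(s)=\sum_{k=1}^{m} a_k k^{-s}$ (a function of the complex variable $s$) and $r\in\mathbb{R}$, the function $\kappa_r:(0,\infty)\to\mathbb{C}$ is defined by $$\kappa_r(x)=\sum_{k\le x}\frac{a_k}{k^{\,r-1/2}},$$ where the sum is over positive integers $k\le x$, with the convention $a_k=0$ for $k>m$ (so $\kappa_r(x)=0$ for $0<x<1$). $\mathbf{1}_{(0,1)}$ is the characteristic function of the interval $(0,1)$. *)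

(* Defs.v *)
From mathcomp Require Export all_boot all_order all_algebra.
From mathcomp Require Export all_classical all_reals all_analysis.

Set Implicit Arguments.
Unset Strict Implicit.
Unset Printing Implicit Defensive.

Export Order.TTheory GRing.Theory Num.Theory.
Export numFieldNormedType.Exports.
From mathcomp Require Export complex.
Export ComplexField.Normc.

#[export] Set Implicit Arguments.
#[export] Unset Strict Implicit.
#[export] Unset Printing Implicit Defensive.

Local Open Scope classical_set_scope.
Local Open Scope ring_scope.
Local Open Scope complex_scope.

Section DirichletPolynomial.
Variable R : realType.

Definition expC (z : R[i]) : R[i] :=
  (expR (Re z))%:C * (cos (Im z) +i* sin (Im z)).

(* For k > 0, k ^ z = exp (z log k) with the real logarithm of k. *)
Definition natpowC (k : nat) (z : R[i]) : R[i] := expC (z * (ln k%:R)%:C).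

(* A family a_1, ..., a_m is a function on nat of which only the values at
   1, ..., m are ever used. *)
Definition dirichlet_poly (m : nat) (a : nat -> R[i]) (s : R[i]) : R[i] :=
  \sum_(1 <= k < m.+1) a k * natpowC k (- s).

(* The bound k <= m implements the convention a_k = 0 for k > m. *)
Definition kappa (m : nat) (a : nat -> R[i]) (r x : R) : R[i] :=
  \sum_(1 <= k < m.+1 | k%:R <= x) a k / (k%:R `^ (r - 2^-1))%:C.

Definition sq_error (m : nat) (a : nat -> R[i]) (r : R) (n : nat)
    (b : nat -> R[i]) : \bar R :=
  (\int[lebesgue_measure]_(x in `]0%R, +oo[)
    ((normc ((\1_(`]0, 1[ : set R) x)%:C
       - \sum_(1 <= k < n.+1) b k * kappa m a r (k%:R * x)^-1)) ^+ 2)%:E)%E.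

(* The infimum is finite, so that fine loses nothing: see dist_sqr. *)
Definition dist (m : nat) (a : nat -> R[i]) (r : R) (n : nat) : R :=
  Num.sqrt (fine (ereal_inf (range (sq_error m a r n)))).

Lemma sq_error_ge0 m a r n b : (0 <= sq_error m a r n b)%E.
Proof. by apply: integral_ge0 => x _; rewrite lee_fin sqr_ge0. Qed.

Lemma sq_error0 m a r n : sq_error m a r n (fun=> 0) = 1%E.
Proof.
rewrite /sq_error.
under eq_integral => x _.
  rewrite big1 ?subr0; last by move=> k _; rewrite mul0r.
  have -> : normc ((\1_(`]0, 1[ : set R) x)%:C : R[i]) ^+ 2
      = \1_(`]0, 1[ : set R) x.
    rewrite sqr_sqrtr /= ?addr_ge0 ?sqr_ge0 // expr0n addr0 indicE.
    by case: (_ \in _); rewrite ?expr1n ?expr0n.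
  over.
rewrite integral_indic //= setIidl; last first.
  by move=> x /=; rewrite !in_itv /= andbT => /andP[].
by rewrite lebesgue_measure_itv /= lte_fin ltr01 oppr0 adde0.
Qed.

Lemma dist_sqr m a r n :
  ((dist m a r n ^+ 2)%:E = ereal_inf (range (sq_error m a r n)))%E.
Proof.
have inf_ge0 : (0 <= ereal_inf (range (sq_error m a r n)))%E.
  by apply: le_ereal_inf_tmp => _ [b _ <-]; exact: sq_error_ge0.
have inf_le1 : (ereal_inf (range (sq_error m a r n)) <= 1)%E.
  by apply: ereal_inf_lbound; exists (fun=> 0) => //; exact: sq_error0.
rewrite /dist sqr_sqrtr ?fine_ge0 // fineK // ge0_fin_numE //.
by apply: le_lt_trans inf_le1 _; rewrite ltry.
Qed.

End DirichletPolynomial.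

(* Main.v *)
(* Put p_j = a_j j^-r and Q(s) = sum_j p_j j^-s = P(r + s), so that the half-plane
   becomes Re s > 0. Since kappa_r(1/(kx)) is a combination of the indicators of
   the intervals (0, 1/(jk)], the integral is the Hilbert norm of the step
   function whose coefficients are those of the Dirichlet polynomial 1 - Q D,
   where D is built from the b_k.

   If Q(s) = 0 with Re s > 0, evaluation of Dirichlet polynomials at s is a
   bounded functional (Abel summation) that takes the value 1 on every 1 - Q D,
   so the distances stay away from 0.

   Conversely let Q be zero-free in Re s > 0.
   - |Q| is bounded below on every half-plane Re s >= sigma > 0, uniformly in
     Im s: a quantitative form of Hurwitz's theorem, obtained by following roots
     of Taylor polynomials of growing degree.
   - Parseval on vertical lines then shows that the coefficients c_n of the
     Dirichlet series 1/Q are O(n^eps) for every eps > 0, so that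
     sum c_n lambda^Omega(n) n^-it converges absolutely for |lambda| < 1.
   - Hence the polynomial lambda |-> sum_j p_j lambda^Omega(j) j^-it has no zero
     in the unit disc, which bounds |Q(it) / Q_lambda(it)| by 2^degree. With D
     a long partial sum of 1/Q_lambda, the products Q D are therefore uniformly
     bounded on Re s = 0, while their coefficients tend to those of 1 as
     lambda -> 1.
   - The Hilbert norm is dominated by the supremum on Re s = 0 (transference
     over the divisors of a large integer, where dilations act almost
     isometrically), so Q D -> 1 weakly. Convexity turns this into norm
     convergence of the distances to 0. *)
Require Import Defs.
From mathcomp Require Import measurable_realfun ring lra zify.

Local Open Scope classical_set_scope.
Local Open Scope ring_scope.
Local Open Scope complex_scope.

(** * Complex modulus and exponential *)

Section ComplexBasics.
Variable R : realType.
Implicit Types (x y : R) (z w : R[i]).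

Lemma ReD z w : Re (z + w) = Re z + Re w. Proof. by case: z w => ? ? []. Qed.
Lemma ReN z : Re (- z) = - Re z. Proof. by case: z. Qed.
Lemma ImD z w : Im (z + w) = Im z + Im w. Proof. by case: z w => ? ? []. Qed.
Lemma ImN z : Im (- z) = - Im z. Proof. by case: z. Qed.
Lemma ReB z w : Re (z - w) = Re z - Re w. Proof. by rewrite ReD ReN. Qed.
Lemma ReM z w : Re (z * w) = Re z * Re w - Im z * Im w.
Proof. by case: z w => ? ? []. Qed.
Lemma ImM z w : Im (z * w) = Re z * Im w + Im z * Re w.
Proof. by case: z w => ? ? [? ?] /=. Qed.
Lemma ReZ x z : Re (x%:C * z) = x * Re z.
Proof. by case: z => ? ?; rewrite ReM /= mul0r subr0. Qed.
Lemma ImZ x z : Im (x%:C * z) = x * Im z.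
Proof. by case: z => ? ?; rewrite ImM /= mul0r addr0. Qed.

Lemma Re_sum (I : Type) (r : seq I) (P : pred I) (F : I -> R[i]) :
  @Re R (\sum_(i <- r | P i) F i) = \sum_(i <- r | P i) Re (F i).
Proof. by apply: (big_morph (@Re R)) => //; exact: ReD. Qed.

Lemma Im_sum (I : Type) (r : seq I) (P : pred I) (F : I -> R[i]) :
  @Im R (\sum_(i <- r | P i) F i) = \sum_(i <- r | P i) Im (F i).
Proof. by apply: (big_morph (@Im R)) => //; exact: ImD. Qed.

Lemma normc_ge0 z : 0 <= normc z. Proof. by case: z => a b; exact: sqrtr_ge0. Qed.

Lemma sqr_normcE z : normc z ^+ 2 = Re z ^+ 2 + Im z ^+ 2.
Proof. by case: z => a b /=; rewrite sqr_sqrtr // addr_ge0 ?sqr_ge0. Qed.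

Lemma sqr_normcJ z : normc z ^+ 2 = Re (z * conjc z).
Proof. by rewrite sqr_normcE; case: z => a b /=; ring. Qed.

Lemma normc_conjc z : normc (conjc z) = normc z.
Proof. by case: z => a b /=; rewrite sqrrN. Qed.

Lemma normc_real x : normc x%:C = `|x|.
Proof. by rewrite /= expr0n addr0 sqrtr_sqr. Qed.

Lemma normc_eq0 z : (normc z == 0) = (z == 0).
Proof. by apply/eqP/eqP => [/eq0_normc //|->]; rewrite normc0. Qed.

Lemma normc_gt0 z : (0 < normc z) = (z != 0).
Proof. by rewrite lt_def normc_ge0 andbT normc_eq0. Qed.

Lemma normcX z n : normc (z ^+ n) = normc z ^+ n.
Proof. by elim: n => [|n IH]; rewrite ?normc1 // !exprS normcM IH. Qed.

Lemma normcB z w : normc (z - w) <= normc z + normc w.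
Proof. by rewrite (le_trans (le_normcD _ _)) // normcN. Qed.

Lemma normcB_ge z w : normc z - normc w <= normc (z - w).
Proof. by rewrite lerBlDr -{1}(subrK w z) le_normcD. Qed.

Lemma normc_distC z w : normc (z - w) = normc (w - z).
Proof. by rewrite -normcN opprB. Qed.

Lemma Re_le_normc z : Re z <= normc z.
Proof.
rewrite (le_trans (ler_norm _)) // -sqrtr_sqr; case: z => a b /=.
by rewrite ler_wsqrtr // lerDl sqr_ge0.
Qed.

Lemma normc_sum (I : Type) (r : seq I) (P : pred I) (F : I -> R[i]) :
  normc (\sum_(i <- r | P i) F i) <= \sum_(i <- r | P i) normc (F i).
Proof.
elim/big_ind2 : _ => [|a b c d ac bd|//]; first by rewrite normc0.
by rewrite (le_trans (le_normcD _ _)) // lerD.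
Qed.

Lemma sqr_normc_sum (I : Type) (r : seq I) (P : pred I) (F : I -> R[i]) :
  normc (\sum_(i <- r | P i) F i) ^+ 2 =
  \sum_(i <- r | P i) \sum_(j <- r | P j) Re (F i * conjc (F j)).
Proof.
rewrite sqr_normcJ rmorph_sum big_distrlr Re_sum.
by apply: eq_bigr => i _; exact: Re_sum.
Qed.

Lemma sqr_normcD_le z w : normc (z + w) ^+ 2 <= 2 * normc z ^+ 2 + 2 * normc w ^+ 2.
Proof.
case: z w => [a b] [c d]; rewrite !sqr_normcE /=.
have := sqr_ge0 (a - c); have := sqr_ge0 (b - d); nra.
Qed.

Lemma conjcM z w : conjc (z * w) = conjc z * conjc w.
Proof. exact: rmorphM. Qed.

Lemma natC n : (n%:R : R[i]) = (n%:R)%:C.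
Proof. by rewrite rmorph_nat. Qed.

Lemma expC0 : expC (0 : R[i]) = 1.
Proof. by rewrite /expC /= expR0 cos0 sin0 mul1r. Qed.

Lemma expCD z w : expC (z + w) = expC z * expC w.
Proof.
rewrite /expC ReD ImD expRD cosD sinD; apply/eqP.
by rewrite eq_complex /=; apply/andP; split; apply/eqP; ring.
Qed.

Lemma conjc_expC_imag x : conjc (expC (0 +i* x)) = expC (0 +i* (- x)) :> R[i].
Proof.
rewrite /expC /= cosN sinN; apply/eqP.
by rewrite eq_complex /= !mul0r !subr0 !addr0 mulrN !eqxx.
Qed.

Lemma normc_expC z : normc (expC z) = expR (Re z).
Proof.
rewrite /expC normcM normc_real ger0_norm ?expR_ge0 //=.
by rewrite cos2Dsin2 sqrtr1 mulr1.
Qed.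

End ComplexBasics.

(** * Taylor remainder of the complex exponential *)

Section Taylor.
Variable R : realType.
Implicit Types (z w : R[i]) (t : R).

Let expRe z w t : R := Re (w * expC (t%:C * z)).
Let polRe z w n t : R := \sum_(k < n) (Re (w * z ^+ k) / k`!%:R) * t ^+ k.

Let is_derive_expRe z w t : is_derive t 1 (expRe z w) (expRe z (w * z) t).
Proof.
case: z w => x y [a b].
have -> : expRe (x +i* y) (a +i* b) =
  (fun t => expR (x * t) * (a * cos (y * t) - b * sin (y * t))).
  apply/funext => u; rewrite /expRe /expC ReM ReZ ImZ /=.
  by rewrite !mul0r !subr0 !addr0 ![u * _]mulrC; ring.
rewrite /expRe /expC ReM ReZ ImZ /= !mul0r !subr0 !addr0 ![t * _]mulrC.
have dx : is_derive t 1 (fun u => x * u) x.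
  by apply: is_derive_eq; rewrite /GRing.scale /= mulr1.
have dy : is_derive t 1 (fun u => y * u) y.
  by apply: is_derive_eq; rewrite /GRing.scale /= mulr1.
have dE : is_derive t 1 (fun u => expR (x * u)) (expR (x * t) * x).
  exact: (is_derive1_comp (f := @expR R)).
have dC : is_derive t 1 (fun u => cos (y * u)) (- sin (y * t) * y).
  exact: (is_derive1_comp (f := @cos R)).
have dS : is_derive t 1 (fun u => sin (y * u)) (cos (y * t) * y).
  exact: (is_derive1_comp (f := @sin R)).
apply: is_derive_eq.
rewrite /GRing.scale /=. ring.
Qed.

Let is_derive_sumX (c : nat -> R) n t :
  is_derive t 1 (fun u => \sum_(k < n) c k * u ^+ k)
    (\sum_(k < n) c k * (k%:R * t ^+ k.-1)).
Proof.
elim: n => [|n IH].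
  by under eq_fun do rewrite big_ord0; rewrite big_ord0; exact: is_derive_cst.
under eq_fun do rewrite big_ord_recr /=.
rewrite big_ord_recr /=.
apply: is_deriveD.
have dX : is_derive t 1 (fun u : R => u ^+ n) (n%:R * t ^+ n.-1).
  have -> : (fun u : R => u ^+ n) = (id : R -> R) ^+ n.
    by apply/funext => u; rewrite exprfctE.
  by apply: is_derive_eq; rewrite /GRing.scale /= mulr1.
by apply: is_derive_eq; rewrite /GRing.scale /=.
Qed.

Let is_derive_polRe z w n t :
  is_derive t 1 (polRe z w n.+1) (polRe z (w * z) n t).
Proof.
rewrite /polRe.
suff -> : \sum_(k < n) Re (w * z * z ^+ k) / k`!%:R * t ^+ k =
    \sum_(k < n.+1) Re (w * z ^+ k) / k`!%:R * (k%:R * t ^+ k.-1).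
  exact: (is_derive_sumX (fun k => Re (w * z ^+ k) / k`!%:R)).
symmetry.
rewrite big_ord_recl /= mul0r mulr0 add0r; apply: eq_bigr => k _.
rewrite /bump /= add1n add0n factS natrM exprS mulrA.
have k0 : k.+1%:R != 0 :> R by rewrite pnatr_eq0.
have f0 : k`!%:R != 0 :> R by rewrite pnatr_eq0 -lt0n fact_gt0.
by move: k.+1%:R k0 => s s0; field; rewrite f0 s0.
Qed.

Let derive1_is (f : R -> R) t d : is_derive t 1 f d -> derive1 f t = d.
Proof. by move=> df; rewrite derive1E derive_val. Qed.

(** Induction on [n]: differentiating in t replaces [w] by [w * z] and lowers [n] by one, so by the
    previous bound the difference [g] of bound and remainder is nondecreasing on [0, 1], and it
    vanishes at 0. *)
Let taylor_bound n z w t : 0 <= t -> t <= 1 ->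
  expRe z w t - polRe z w n t
    <= normc w * normc z ^+ n * expR (normc z) / n`!%:R * t ^+ n.
Proof.
elim: n w t => [|n IH] w t t0 t1.
  rewrite /polRe big_ord0 subr0 expr0 !mulr1 divr1.
  rewrite (le_trans (Re_le_normc _)) // normcM normc_expC ler_wpM2l ?normc_ge0 //.
  rewrite ler_expR ReZ (le_trans (ler_wpM2l t0 (Re_le_normc z))) //.
  by rewrite -[leRHS]mul1r ler_wpM2r // normc_ge0.
pose K : R := normc w * normc z ^+ n.+1 * expR (normc z) / n.+1`!%:R.
pose g (u : R) : R := K * u ^+ n.+1 - (expRe z w u - polRe z w n.+1 u).
pose dg (u : R) : R := K * (n.+1%:R * u ^+ n) - (expRe z (w * z) u - polRe z (w * z) n u).
have dgP (u : R) : is_derive u 1 g (dg u).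
  have dX : is_derive u 1 (fun u : R => u ^+ n.+1) (n.+1%:R * u ^+ n).
    have -> : (fun u : R => u ^+ n.+1) = (id : R -> R) ^+ n.+1.
      by apply/funext => v; rewrite exprfctE.
    by apply: is_derive_eq; rewrite /GRing.scale /= mulr1.
  have d1 := is_derive_expRe z w u; have d2 := is_derive_polRe z w n u.
  by apply: is_derive_eq; rewrite /dg.
have dg0 u : 0 <= u -> u <= 1 -> 0 <= dg u.
  move=> u0 u1; rewrite /dg subr_ge0 (le_trans (IH _ _ u0 u1)) //.
  rewrite /K normcM factS natrM exprS le_eqVlt; apply/orP; left; apply/eqP.
  have k0 : n.+1%:R != 0 :> R by rewrite pnatr_eq0.
  have f0 : n`!%:R != 0 :> R by rewrite pnatr_eq0 -lt0n fact_gt0.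
  by move: n.+1%:R k0 => s s0; field; rewrite f0 s0.
have : g 0 <= g t.
  have gD (u : R) : derivable g u 1 by case: (dgP u).
  apply: (@ger0_derive1_ndecr _ g 0 1) => //.
    move=> u; rewrite in_itv /= => /andP[/ltW u0 /ltW u1].
    by rewrite (derive1_is (dgP u)); exact: dg0.
  apply: continuous_subspaceT => u; apply: differentiable_continuous.
  exact/derivable1_diffP.
rewrite /g expr0n /= mulr0 sub0r => g0.
rewrite -subr_ge0 (le_trans _ g0) // oppr_ge0.
rewrite /expRe /polRe mul0r expC0 mulr1 big_ord_recl /= expr0 !mulr1 divr1 big1.
  by rewrite addr0 subrr.
by move=> i _; rewrite expr0n mulr0.
Qed.

(** Multiplying the error E by its conjugate gives |E|^2 as a real part, which reduces the complex
    estimate to the real one at t = 1; one factor |E| is then cancelled. *)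
Lemma expC_taylor n z :
  normc (expC z - \sum_(k < n) z ^+ k / k`!%:R)
    <= normc z ^+ n * expR (normc z) / n`!%:R.
Proof.
set E := expC z - _.
have [->|E0] := eqVneq E 0.
  by rewrite normc0 !mulr_ge0 ?exprn_ge0 ?normc_ge0 ?expR_ge0 ?invr_ge0.
have := taylor_bound n z (conjc E) ler01 (lexx _).
have -> : expRe z (conjc E) 1 - polRe z (conjc E) n 1 = normc E ^+ 2.
  rewrite sqr_normcJ [in RHS]mulrC {3}/E mulrBr ReB /expRe mul1r; congr (_ - _).
  rewrite mulr_sumr Re_sum; apply: eq_bigr => k _.
  rewrite expr1n mulr1 mulrA natC -(rmorphV (real_complex R)) ?unitfE ?pnatr_eq0 -?lt0n ?fact_gt0 //.
  by rewrite [in RHS]mulrC ReZ mulrC.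
by rewrite normc_conjc expr1n mulr1 expr2 -!mulrA ler_pM2l // normc_gt0.
Qed.

End Taylor.

(** * Dirichlet polynomials and convolution *)

Lemma sum_multiples (V : nmodType) (G : nat -> V) (j N X : nat) :
  (0 < j)%N -> (j * N <= X)%N ->
  (forall n, (0 < n)%N -> (j %| n)%N -> (N < n %/ j)%N -> G n = 0) ->
  \sum_(1 <= n < X.+1 | (j %| n)%N) G n = \sum_(1 <= k < N.+1) G (j * k)%N.
Proof.
move=> j0 jNX G0.
rewrite (bigID (fun n => (n %/ j <= N)%N)) /= [X in _ + X]big_nat_cond.
rewrite [X in _ + X]big1 ?addr0; last first.
  move=> n /andP[/andP[n0 _] /andP[jn]]; rewrite -ltnNge; exact: G0.
rewrite -(big_map (muln j) xpredT G) -big_filter; apply: perm_big.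
apply: uniq_perm.
- exact/filter_uniq/iota_uniq.
- by rewrite map_inj_uniq ?iota_uniq // => a b /eqP; rewrite eqn_pmul2l // => /eqP.
move=> n; rewrite mem_filter mem_index_iota.
apply/idP/mapP => [/andP[/andP[jn nN] /andP[n0 nX]]|[k]].
  exists (n %/ j)%N; last by rewrite mulnC divnK.
  by rewrite mem_index_iota ltnS nN andbT divn_gt0 // dvdn_leq.
rewrite mem_index_iota ltnS => /andP[k0 kN] ->.
rewrite dvdn_mulr // mulKn // kN muln_gt0 j0 k0 /= ltnS.
by rewrite (leq_trans _ jNX) // leq_mul2l kN orbT.
Qed.

(* Dirichlet convolution; the first factor is cut off at m. *)
Definition dconv (V : pzSemiRingType) (m : nat) (p y : nat -> V) (n : nat) : V :=
  \sum_(1 <= j < m.+1 | (j %| n)%N) p j * y (n %/ j)%N.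

(** Serves the three completely multiplicative twists n^-s, lambda^Omega(n) and sqrt n. *)
Lemma dconv_twist (V : comPzSemiRingType) (m : nat) (u p y : nat -> V) (n : nat) :
  (forall j k, (0 < j)%N -> (0 < k)%N -> u (j * k)%N = u j * u k) -> (0 < n)%N ->
  dconv m (fun j => u j * p j) (fun k => u k * y k) n = u n * dconv m p y n.
Proof.
move=> uM n0; rewrite /dconv big_distrr /= big_nat_cond [RHS]big_nat_cond.
apply: eq_bigr => j /andP[/andP[j0 _] jn].
rewrite -{3}(divnK jn) uM ?divn_gt0 // 1?dvdn_leq // mulrACA.
by rewrite [u j * u _]mulrC.
Qed.

Lemma eq_dconv (V : pzSemiRingType) (m : nat) (p q y z : nat -> V) (n : nat) :
  (0 < n)%N -> (forall j, (0 < j <= m)%N -> p j = q j) ->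
  (forall k, (0 < k <= n)%N -> y k = z k) -> dconv m p y n = dconv m q z n.
Proof.
move=> n0 pq yz; rewrite /dconv big_nat_cond [RHS]big_nat_cond.
apply: eq_bigr => j /andP[/andP[j0 jm] jn].
by rewrite pq ?yz ?j0 // divn_gt0 // dvdn_leq //= leq_div.
Qed.

(** A term with n = j l > N and j <= m has m l > N, so only the top range of [Y] contributes, at
    most once for each j. *)
Lemma sum_dconv_tail_le (F : numDomainType) (m N : nat) (P Y : nat -> F) :
  (forall j, 0 <= P j) -> (forall l, 0 <= Y l) -> (forall l, (N < l)%N -> Y l = 0) ->
  \sum_(N.+1 <= n < (m * N).+1) dconv m P Y n <=
  (\sum_(1 <= j < m.+1) P j) * \sum_(1 <= l < N.+1 | (N < m * l)%N) Y l.
Proof.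
move=> P0 Y0 YN; rewrite /dconv (exchange_big_dep_nat xpredT) //= mulr_suml.
rewrite !big_nat; apply: ler_sum => j /andP[j0 jm].
pose X := (m * N)%N.
apply: (@le_trans _ _ (P j *
    \sum_(1 <= n < X.+1 | (j %| n)%N) (if (N < n)%N then Y (n %/ j)%N else 0))).
  have [NX|XN] := leqP N X; last first.
    rewrite big_geq ?mulr_ge0 ?sumr_ge0 // => [i _|]; last by rewrite ltnS ltnW.
    by case: ifP.
  rewrite mulr_sumr [leRHS](@big_cat_nat _ _ _ N.+1) //= ler_wpDl //.
    by rewrite sumr_ge0 // => n _; rewrite mulr_ge0 //; case: ifP.
  by rewrite big_nat_cond [leRHS]big_nat_cond; apply: ler_sum => n /andP[/andP[-> _] _].
rewrite ler_wpM2l // (sum_multiples (N := N)) //; last 2 first.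
- by rewrite leq_mul2r -ltnS jm orbT.
- by move=> n n0 jn Nn; rewrite YN //; case: ifP.
rewrite [leRHS]big_mkcond !big_nat; apply: ler_sum => l _; rewrite mulKn //.
case: ifP => [Njl|_]; last by case: ifP.
by rewrite (leq_trans Njl) // leq_mul2r -ltnS jm orbT.
Qed.

Section DirichletPolynomials.
Variable R : realType.
Implicit Types (s z w : R[i]) (k l m n N : nat) (p y : nat -> R[i]).

Lemma natpowC1 s : natpowC 1 s = 1.
Proof. by rewrite /natpowC ln1 mulr0 expC0. Qed.

Lemma natpowC0 k : natpowC k (0 : R[i]) = 1.
Proof. by rewrite /natpowC mul0r expC0. Qed.

Lemma natpowCD k z w : natpowC k (z + w) = natpowC k z * natpowC k w.
Proof. by rewrite /natpowC mulrDl expCD. Qed.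

Lemma natpowCM k l s : (0 < k)%N -> (0 < l)%N ->
  natpowC (k * l) s = natpowC k s * natpowC l s.
Proof.
move=> k0 l0; rewrite /natpowC natrM lnM ?posrE ?ltr0n //.
by rewrite rmorphD /= mulrDr expCD.
Qed.

Lemma natpowC_real k (x : R) : (0 < k)%N -> natpowC k x%:C = (k%:R `^ x)%:C.
Proof.
move=> k0; rewrite /natpowC -rmorphM /= /expC /= cos0 sin0 mulr1.
by rewrite /powR pnatr_eq0 eqn0Ngt k0.
Qed.

Lemma normc_natpowC k s : (0 < k)%N -> normc (natpowC k s) = k%:R `^ (Re s).
Proof.
move=> k0; rewrite /natpowC normc_expC mulrC ReZ mulrC.
by rewrite /powR pnatr_eq0 eqn0Ngt k0.
Qed.

Lemma dirichlet_polyD m p s z :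
  dirichlet_poly m p (s + z) = dirichlet_poly m (fun k => natpowC k (- s) * p k) z.
Proof.
by apply: eq_bigr => k _; rewrite opprD natpowCD mulrCA mulrA.
Qed.

Lemma dirichlet_poly_trunc N X y s : (N <= X)%N ->
  (forall k, (N < k)%N -> y k = 0) -> dirichlet_poly X y s = dirichlet_poly N y s.
Proof.
move=> NX y0; rewrite /dirichlet_poly (@big_cat_nat _ _ _ N.+1) //=.
rewrite [X in _ + X]big_nat_cond [X in _ + X]big1 ?addr0 //.
by move=> k /andP[/andP[/y0 -> _] _]; rewrite mul0r.
Qed.

Lemma dirichlet_polyM m N p y s : (forall k, (N < k)%N -> y k = 0) ->
  dirichlet_poly m p s * dirichlet_poly N y s = dirichlet_poly (m * N) (dconv m p y) s.
Proof.
move=> y0; rewrite /dirichlet_poly /dconv.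
under [RHS]eq_bigr do rewrite big_distrl /=.
rewrite (exchange_big_dep_nat xpredT) //= big_distrl /=.
rewrite big_nat_cond [RHS]big_nat_cond.
apply: eq_bigr => j; rewrite andbT => /andP[j0 jm].
rewrite (sum_multiples (N := N)) //; last 2 first.
- by rewrite leq_mul2r; apply/orP; right.
- by move=> n n0 jn /y0 ->; rewrite mulr0 mul0r.
rewrite big_distrr /= big_nat_cond [RHS]big_nat_cond.
apply: eq_bigr => k; rewrite andbT => /andP[k0 kN].
by rewrite mulKn // natpowCM // mulrACA.
Qed.

End DirichletPolynomials.

(** * Mean values on vertical lines *)

Section MeanValue.
Variable R : realType.

(* Averaging a nonnegative f with its translate by pi / theta kills the
   frequency theta and leaves the constant term unchanged. *)
Lemma trig_mean_ge0 (I : finType) (a : I -> R[i]) (theta : I -> R) :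
  (forall t, 0 <= \sum_i Re (a i * expC (0 +i* (theta i * t)))) ->
  0 <= \sum_(i | theta i == 0) Re (a i).
Proof.
(* [l] lists the indices whose nonzero frequency may still be present; averaging kills the head of
   the list and leaves the terms of frequency 0 unchanged. *)
pose supp (l : seq I) (b : I -> R[i]) :=
  forall i, i \notin l -> theta i != 0 -> b i = 0.
have : supp (enum I) a by move=> i; rewrite mem_enum.
elim: (enum I) a => [|j l IH] a sa a_ge0.
  have := a_ge0 0; rewrite (bigID (fun i => theta i == 0)) /=.
  rewrite [X in _ + X]big1 ?addr0 => [|i /(sa i isT) ->]; last by rewrite mul0r.
  by under eq_bigr do rewrite mulr0 expC0 mulr1.
have [tj0|tj0] := eqVneq (theta j) 0.
  apply: IH => // i il ti0; apply: sa => //; rewrite inE negb_or il andbT.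
  by apply: contraNneq ti0 => ->; rewrite tj0.
pose tau := pi / theta j.
pose b i := a i * ((1 + expC (0 +i* (theta i * tau))) / 2).
have -> : \sum_(i | theta i == 0) Re (a i) = \sum_(i | theta i == 0) Re (b i).
  apply: eq_bigr => i /eqP ti0; rewrite /b ti0 mul0r expC0.
  by rewrite -mulr2n divff ?mulr1 // pnatr_eq0.
apply: IH => [i il ti0|t].
  have [->|ij] := eqVneq i j; last first.
    by rewrite /b sa ?mul0r // inE negb_or ij.
  rewrite /b; have -> : theta j * tau = pi by rewrite /tau mulrCA divff ?mulr1.
  have -> : expC (0 +i* pi) = -1 :> R[i].
    by apply/eqP; rewrite /expC /= expR0 cospi sinpi mul1r eq_complex /= oppr0 !eqxx.
  by rewrite subrr mul0r mulr0.
have -> : \sum_i Re (b i * expC (0 +i* (theta i * t))) =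
    2^-1 * (\sum_i Re (a i * expC (0 +i* (theta i * t))) +
            \sum_i Re (a i * expC (0 +i* (theta i * (t + tau))))).
  rewrite -big_split /= mulr_sumr; apply: eq_bigr => i _.
  rewrite -ReD -ReZ; congr Re; rewrite /b.
  have -> : (0 +i* (theta i * (t + tau))) =
     (0 +i* (theta i * t)) + (0 +i* (theta i * tau)) :> R[i].
    by apply/eqP; rewrite eq_complex /= addr0 mulrDr !eqxx.
  rewrite expCD (rmorphV (real_complex R)) ?unitfE ?pnatr_eq0 // rmorph_nat.
  by ring.
by rewrite mulr_ge0 // ?invr_ge0 // addr_ge0.
Qed.

Lemma natpowC_imag k (t : R) : natpowC k (- (0 +i* t)) = expC (0 +i* (- ln k%:R * t)).
Proof.
rewrite /natpowC; congr expC; apply/eqP; rewrite eq_complex /=.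
by apply/andP; split; apply/eqP; ring.
Qed.

(** In the expansion of |D(it)|^2 the frequencies log l - log k vanish only on the diagonal. Taking
    the mean of the difference of the two squares compares the diagonals without any integration
    over t. *)
Lemma parseval_le N (z w : nat -> R[i]) :
  (forall t : R, normc (dirichlet_poly N z (0 +i* t))
     <= normc (dirichlet_poly N w (0 +i* t))) ->
  \sum_(1 <= n < N.+1) normc (z n) ^+ 2 <= \sum_(1 <= n < N.+1) normc (w n) ^+ 2.
Proof.
move=> zw.
pose theta (u : 'I_N * 'I_N) : R := ln u.2.+1%:R - ln u.1.+1%:R.
pose A (y : nat -> R[i]) (u : 'I_N * 'I_N) := y u.1.+1 * conjc (y u.2.+1).
have sqE (y : nat -> R[i]) t : normc (dirichlet_poly N y (0 +i* t)) ^+ 2 =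
    \sum_u Re (A y u * expC (0 +i* (theta u * t))).
  rewrite /dirichlet_poly big_add1 big_mkord sqr_normc_sum /=.
  rewrite pair_bigA /=; apply: eq_bigr => u _; congr Re.
  rewrite conjcM mulrACA /A; congr (_ * _).
  rewrite !natpowC_imag conjc_expC_imag -expCD; congr expC; apply/eqP.
  by rewrite eq_complex /= addr0 eqxx /theta; apply/eqP; ring.
have diag (y : nat -> R[i]) : \sum_(u | theta u == 0) Re (A y u) =
    \sum_(1 <= n < N.+1) normc (y n) ^+ 2.
  rewrite big_add1 big_mkord /=.
  rewrite (eq_bigl (fun u : 'I_N * 'I_N => u.2 == u.1)); last first.
    move=> [i j]; rewrite /theta /= subr_eq0 -val_eqE /=.
    apply/eqP/eqP => [/ln_inj|->//]; rewrite !posrE !ltr0n => /(_ isT isT) /eqP.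
    by rewrite eqr_nat eqSS => /eqP.
  rewrite -(pair_big_dep xpredT (fun i j : 'I_N => j == i)
     (fun i j => Re (A y (i, j)))) /=.
  by apply: eq_bigr => i _; rewrite big_pred1_eq /A /= sqr_normcJ.
rewrite -subr_ge0 -!diag -sumrB.
under eq_bigr do rewrite -ReB.
apply: trig_mean_ge0 => t.
under eq_bigr do rewrite mulrBl ReB.
by rewrite sumrB -!sqE subr_ge0 lerXn2r ?nnegrE ?normc_ge0.
Qed.

End MeanValue.

(** * Lower bounds in zero-free half-planes *)

(** Each of the n factors n + 1, ..., 2n of (2n)! / n! is at least n. *)
Lemma fact_exp_le n : (n ^ n <= (2 * n)`!)%N.
Proof.
suff H k : (n ^ k * n`! <= (n + k)`!)%N.
  have := H n; rewrite addnn mul2n; apply: leq_trans.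
  by rewrite leq_pmulr // fact_gt0.
elim: k => [|k IH]; first by rewrite expn0 mul1n addn0.
rewrite expnS -mulnA addnS factS leq_mul // -addnS leq_addr //.
Qed.

Section Polynomials.
Variable R : realType.
Implicit Types (s z w : R[i]).

(** Factor [T] over its roots: each linear factor at [z1] is at most [K] times the one at [z2], and
    [K >= 1] allows the number of roots to be replaced by [D]. *)
Lemma poly_ratio (T : {poly R[i]}) (D : nat) (K : R) (z1 z2 : R[i]) :
  1 <= K -> (size T <= D.+1)%N ->
  (forall z, root T z -> normc (z1 - z) <= K * normc (z2 - z)) ->
  normc T.[z1] <= K ^+ D * normc T.[z2].
Proof.
move=> K1 sT rT; have [->|T0] := eqVneq T 0.
  by rewrite !horner0 normc0 mulr0.
have [rs Trs] := closed_field_poly_normal T.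
have lT : lead_coef T != 0 by rewrite lead_coef_eq0.
have srs : (size rs <= D)%N.
  by rewrite -ltnS (leq_trans _ sT) // Trs size_scale // size_prod_XsubC.
have {rT} rT z : z \in rs -> normc (z1 - z) <= K * normc (z2 - z).
  by move=> zrs; apply: rT; rewrite Trs rootZ // root_prod_XsubC.
have K0 : 0 <= K by rewrite (le_trans _ K1).
rewrite Trs !hornerZ !normcM mulrCA ler_wpM2l ?normc_ge0 //.
apply: le_trans (_ : K ^+ size rs * normc (\prod_(z <- rs) ('X - z%:P)).[z2] <= _); last first.
  by rewrite ler_wpM2r ?normc_ge0 // ler_weXn2l.
elim: rs {Trs srs} rT => [|z rs IH] rT.
  by rewrite !big_nil expr0 mul1r !hornerC.
rewrite !big_cons !hornerM !normcM !hornerXsubC /= exprS mulrACA.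
rewrite ler_pM ?normc_ge0 ?rT ?mem_head // IH // => v vrs.
by rewrite rT // inE vrs orbT.
Qed.

(** The Taylor polynomial at 0 of the Dirichlet polynomial, from j^-z = exp(- z log j), keeping the
    powers below n. *)
Definition taylor_poly (m : nat) (a : nat -> R[i]) (n : nat) : {poly R[i]} :=
  \poly_(k < n) (\sum_(1 <= j < m.+1) a j * (- (ln j%:R)%:C) ^+ k / k`!%:R).

Lemma taylor_polyE m a n z :
  (taylor_poly m a n).[z] =
  \sum_(1 <= j < m.+1) a j * \sum_(k < n) (- z * (ln j%:R)%:C) ^+ k / k`!%:R.
Proof.
rewrite horner_poly; under eq_bigr do rewrite mulr_suml.
rewrite exchange_big; apply: eq_bigr => j _; rewrite mulr_sumr.
apply: eq_bigr => k _; rewrite -!mulrA; congr (_ * _).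
by rewrite mulrCA -exprMn mulrC !mulNr [_%:C * z]mulrC.
Qed.

Lemma taylor_poly0 m a n : (taylor_poly m a n.+1).[0] = dirichlet_poly m a 0.
Proof.
rewrite taylor_polyE; apply: eq_bigr => j _; congr (_ * _).
rewrite oppr0 natpowC0 big_ord_recl big1 ?addr0 ?mul0r ?expr0 ?divr1 // => k _.
by rewrite expr0n mul0r.
Qed.

Lemma taylor_poly_error m a n z (rho : R) : normc z <= rho ->
  normc (dirichlet_poly m a z - (taylor_poly m a n).[z]) <=
  (\sum_(1 <= j < m.+1) normc (a j)) *
  ((ln m%:R * rho) ^+ n * expR (ln m%:R * rho) / n`!%:R).
Proof.
move=> zr; rewrite taylor_polyE /dirichlet_poly -sumrB mulr_suml.
apply: (le_trans (normc_sum _ _ _)).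
rewrite !big_nat; apply: ler_sum => j /andP[j0 jm].
have lj0 : 0 <= ln j%:R :> R by rewrite ln_ge0 // ler1n.
have ljm : ln j%:R <= ln m%:R :> R.
  by rewrite ler_ln ?posrE ?ltr0n // ?ler_nat // (leq_trans j0).
have zl : normc (- z * (ln j%:R)%:C) <= ln m%:R * rho.
  rewrite normcM normcN normc_real ger0_norm // mulrC.
  by rewrite ler_pM // normc_ge0.
rewrite -mulrBr normcM ler_wpM2l ?normc_ge0 //.
apply: (le_trans (expC_taylor _ _)).
rewrite ler_wpM2r ?invr_ge0 // ler_pM ?exprn_ge0 ?normc_ge0 ?expR_ge0 //.
  by rewrite lerXn2r ?nnegrE ?normc_ge0 // (le_trans _ zl) ?normc_ge0.
by rewrite ler_expR.
Qed.

End Polynomials.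

Section LowerBound.
Variable R : realType.
Implicit Types (s z w : R[i]).

Let continuous_sumr (T : topologicalType) (I : Type) (r : seq I) (g : I -> T -> R) :
  (forall i, continuous (g i)) -> continuous (fun u => \sum_(i <- r) g i u).
Proof.
move=> cg; elim: r => [|i r IH].
  by under eq_fun do rewrite big_nil; exact: cst_continuous.
under eq_fun do rewrite big_cons.
by move=> u; apply: continuousD; [exact: cg|exact: IH].
Qed.

Lemma continuous_normc_dirichlet m (a : nat -> R[i]) :
  continuous (fun u : R * R => normc (dirichlet_poly m a (u.1 +i* u.2))).
Proof.
pose c (l : R) (al be : R) (u : R * R) := expR (- l * u.1) *
  (al * cos (- l * u.2) - be * sin (- l * u.2)).
have cc l al be : continuous (c l al be).
  move=> u; rewrite /c.
  have cl1 : {for u, continuous (fun u : R * R => - l * u.1)}.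
    by apply: continuousM; [exact: cst_continuous|exact: cvg_fst].
  have cl2 : {for u, continuous (fun u : R * R => - l * u.2)}.
    by apply: continuousM; [exact: cst_continuous|exact: cvg_snd].
  have cE : {for u, continuous (expR \o (fun u : R * R => - l * u.1))}.
    by apply: continuous_comp => //; exact: continuous_expR.
  have cC : {for u, continuous (cos \o (fun u : R * R => - l * u.2))}.
    by apply: continuous_comp => //; exact: continuous_cos.
  have cN : {for u, continuous (sin \o (fun u : R * R => - l * u.2))}.
    by apply: continuous_comp => //; exact: continuous_sin.
  apply: cvgM; first exact: cE.
  by apply: cvgB; apply: cvgM; [exact: cvg_cst|exact: cC|exact: cvg_cst|exact: cN].
have ReE (u : R * R) : Re (dirichlet_poly m a (u.1 +i* u.2)) =
    \sum_(1 <= k < m.+1) c (ln k%:R) (Re (a k)) (Im (a k)) u.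
  rewrite /dirichlet_poly Re_sum; apply: eq_bigr => k _.
  rewrite /natpowC /expC ReM ReZ ImZ ReM ImM /= mulr0 subr0 mulr0 add0r.
  by rewrite /c !mulNr ![ln _ * _]mulrC; ring.
have ImE (u : R * R) : Im (dirichlet_poly m a (u.1 +i* u.2)) =
    \sum_(1 <= k < m.+1) c (ln k%:R) (Im (a k)) (- Re (a k)) u.
  rewrite /dirichlet_poly Im_sum; apply: eq_bigr => k _.
  rewrite /natpowC /expC ImM ReZ ImZ ReM ImM /= mulr0 subr0 mulr0 add0r.
  by rewrite /c !mulNr ![ln _ * _]mulrC; ring.
have normcE z : normc z = Num.sqrt (Re z ^+ 2 + Im z ^+ 2) by case: z.
under eq_fun do rewrite normcE ReE ImE.
move=> u; apply: continuous_cvg; first exact: sqrt_continuous.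
by apply: cvgD; rewrite expr2; under eq_fun do rewrite expr2; apply: cvgM;
  apply: continuous_sumr.
Qed.

(** Compactness. A square, being a product of segments, is used in place of a disc. *)
Lemma dirichlet_min_square m (a : nat -> R[i]) (rho : R) : 0 <= rho ->
  (forall z, `|Re z| <= rho -> `|Im z| <= rho -> dirichlet_poly m a z != 0) ->
  exists2 mu : R, 0 < mu &
    forall z, `|Re z| <= rho -> `|Im z| <= rho -> mu <= normc (dirichlet_poly m a z).
Proof.
move=> rho0 nz.
pose S : set (R * R) := `[- rho, rho]%classic `*` `[- rho, rho]%classic.
have cS : compact S by apply: compact_setX; exact: segment_compact.
have S0 : S !=set0 by exists (0, 0); rewrite /S /= !in_itv /= oppr_le0 rho0.
have cf := continuous_subspaceT (A := S) (@continuous_normc_dirichlet m a).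
have [[x y] /= xyS minf] := compact_EVT_min S0 cS cf.
have inS z : (Re z, Im z) \in S = (`|Re z| <= rho) && (`|Im z| <= rho).
  apply/idP/andP => [|[zr zi]].
    by rewrite inE /S /= !in_itv /= => -[]; rewrite -!ler_norml.
  by rewrite inE /S /= !in_itv /= -!ler_norml.
have /andP[xr yr] := xyS; rewrite (inS (x +i* y)) /= in xyS.
exists (normc (dirichlet_poly m a (x +i* y))).
  by rewrite normc_gt0; case/andP: xyS => ? ?; exact: nz.
move=> z zr zi; have := minf (Re z, Im z); rewrite inS zr zi /= => /(_ isT).
by case: z {zr zi}.
Qed.

End LowerBound.

Section LowerBound.
Variable R : realType.
Implicit Types (s z w : R[i]).

(* The factorial beats the k-th gap (9/10)^k of the radii because the degree
   doubles at each step and 2 * (9/10)^4 >= 1. *)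
Let degree_choice (E B beta c : R) : 0 < E -> 1 <= B -> 0 < beta -> 0 < c ->
  exists2 D : nat, (0 < D)%N & forall k n, n = (D * 2 ^ k)%N ->
    E * (B ^+ (2 * n) / (2 * n)`!%:R) < beta / 2 * (c * (9 / 10) ^+ k) ^+ (4 * n).
Proof.
move=> E0 B1 b0 c0.
pose X := B ^+ 2 / c ^+ 4 * (1 + 2 * E / beta).
have BB : 0 < B ^+ 2 by rewrite exprn_gt0 // (lt_le_trans ltr01).
have Eb : 0 < 2 * E / beta by rewrite divr_gt0 // mulr_gt0 // ltr0n.
have X0 : 0 < X by rewrite mulr_gt0 // ?addr_gt0 // divr_gt0 // exprn_gt0.
have [D DX] : exists D : nat, X < D%:R.
  by exists (Num.bound X); rewrite archi_boundP // ltW.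
have D0 : (0 < D)%N by rewrite -(ltr0n R) (lt_trans X0).
exists D => // k n nE.
have n0 : (0 < n)%N by rewrite nE muln_gt0 D0 expn_gt0.
have nR0 : 0 < n%:R :> R by rewrite ltr0n.
pose g := c * (9 / 10) ^+ k.
have g0 : 0 < g by rewrite mulr_gt0 // exprn_gt0 //; lra.
(* [y ^+ n] is the quotient of the two powers once (2n)! is replaced by the smaller n^n. The choice
   of [X] gives both [y < 1] and [E * y < beta / 2]. *)
pose y := B ^+ 2 / (n%:R * g ^+ 4).
have y0 : 0 < y by rewrite divr_gt0 // mulr_gt0 // exprn_gt0.
have yE : y * (1 + 2 * E / beta) < 1.
  rewrite /y mulrAC ltr_pdivrMr ?mul1r ?mulr_gt0 ?exprn_gt0 //.
  have : D%:R * c ^+ 4 <= n%:R * g ^+ 4.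
    rewrite nE natrM natrX -mulrA ler_wpM2l // /g exprMn -exprM mulnC exprM.
    rewrite mulrCA -exprMn -{1}[c ^+ 4]mulr1 ler_wpM2l ?exprn_ge0 ?(ltW c0) //.
    by rewrite exprn_ege1 //; lra.
  apply: lt_le_trans; rewrite -ltr_pdivrMr ?exprn_gt0 //.
  by rewrite mulrAC.
have y1 : y < 1.
  apply: le_lt_trans yE; rewrite -{1}[y]mulr1 ler_wpM2l ?ltW // ltrDl.
  by rewrite divr_gt0 // mulr_gt0 // ltr0n.
have Ey : E * y < beta / 2.
  move: yE; rewrite mulrDr mulr1 => yE.
  have : y * (2 * E / beta) < 1 by lra.
  by rewrite mulrA ltr_pdivrMr // mul1r => ?; lra.
have gn : 0 < g ^+ (4 * n) by rewrite exprn_gt0.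
rewrite -/g -ltr_pdivrMr //; apply: le_lt_trans Ey.
rewrite -mulrA ler_wpM2l ?(ltW E0) //.
apply: (@le_trans _ _ (y ^+ n)); last by rewrite -[leRHS]expr1 ler_wiXn2l // ltW.
have -> : y ^+ n = B ^+ (2 * n) / (n%:R ^+ n * g ^+ (4 * n)).
  by rewrite /y expr_div_n [(_ * g ^+ 4) ^+ n]exprMn -!exprM.
clearbody g; rewrite -mulrA -invfM ler_wpM2l ?exprn_ge0 ?(le_trans ler01) //.
rewrite lef_pV2 ?posrE ?mulr_gt0 ?ltr0n ?fact_gt0 ?exprn_gt0 // ler_wpM2r ?(ltW gn) //.
by rewrite -natrX ler_nat fact_exp_le.
Qed.

(* If f is smaller than H_k at a point of the disc of radius r_k, its Taylor
   polynomial of degree 4 n_k has a root in the disc of radius r_(k+1), for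
   otherwise factoring it would bound it from below there; at that root f is
   smaller than H_(k+1). As H_k -> 0, this contradicts the positive minimum of
   |f| on the closed square. The point of the argument is that the starting
   value H_0 is the same for all f with the given bounds. *)
Lemma dirichlet_lower_bound_disc m (A beta rho0 rho1 : R) :
  0 < rho0 -> rho0 < rho1 -> 0 < beta ->
  exists2 delta : R, 0 < delta & forall a : nat -> R[i],
    \sum_(1 <= j < m.+1) normc (a j) <= A ->
    beta <= normc (dirichlet_poly m a 0) ->
    (forall z, `|Re z| <= rho1 -> `|Im z| <= rho1 -> dirichlet_poly m a z != 0) ->
    forall z, normc z <= rho0 -> delta <= normc (dirichlet_poly m a z).
Proof.
move=> r0 r01 b0.
have r1 : 0 < rho1 by rewrite (lt_trans r0).
pose L := ln (m%:R : R) * rho1.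
have L0 : 0 <= L.
  rewrite mulr_ge0 ?(ltW r1) //; case: (m) => [|k]; first by rewrite ln0.
  by rewrite ln_ge0 // ler1n.
pose E := (`|A| + 1) * expR L.
have E0 : 0 < E by rewrite mulr_gt0 ?expR_gt0 // ltr_wpDl.
(* With this [c], r_(k+1) - r_k = rho1 * g_k: each step closes a tenth of the remaining gap between
   r_k and rho1. *)
pose c := (rho1 - rho0) / (10 * rho1).
have c0 : 0 < c by rewrite divr_gt0 ?subr_gt0 // mulr_gt0 // ltr0n.
have c1 : c < 1.
  by rewrite ltr_pdivrMr ?mulr_gt0 ?ltr0n // mul1r; lra.
have [D D0 HD] := degree_choice E0 (ler_wpDl L0 (lexx 1)) b0 c0.
pose n k := (D * 2 ^ k)%N.
pose g k := c * (9 / 10) ^+ k.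
have g0 k : 0 < g k by rewrite mulr_gt0 // exprn_gt0 //; lra.
have gS k : g k.+1 <= g k.
  rewrite /g ler_wpM2l ?(ltW c0) // exprS ler_piMl ?exprn_ge0 //; lra.
have g1 k : g k <= c.
  by elim: k => [|k IH]; [rewrite /g expr0 mulr1|rewrite (le_trans (gS k))].
pose r k := rho1 - (rho1 - rho0) * (9 / 10) ^+ k.
have rS k : r k.+1 = r k + rho1 * g k.
  by rewrite /r /g /c exprS; field; lra.
have rho1r k : r k < rho1.
  by rewrite /r gtrBl mulr_gt0 ?subr_gt0 // exprn_gt0 //; lra.
have r_gt0 k : 0 < r k.
  elim: k => [|k IH]; first by rewrite /r expr0; lra.
  by rewrite rS addr_gt0 // mulr_gt0.
pose H k := beta / 2 * g k ^+ (4 * n k).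
have H0 k : 0 < H k by rewrite mulr_gt0 ?divr_gt0 ?ltr0n // exprn_gt0.
have n0 k : (0 < n k)%N by rewrite muln_gt0 D0 expn_gt0.
have HS k : H k.+1 <= H k.
  rewrite /H ler_wpM2l ?divr_ge0 ?(ltW b0) //.
  apply: (@le_trans _ _ (g k ^+ (4 * n k.+1))).
    by rewrite lerXn2r ?nnegrE ?(ltW (g0 _)).
  rewrite ler_wiXn2l ?(ltW (g0 _)) ?(le_trans (g1 _) (ltW c1)) //.
  by rewrite leq_mul2l leq_mul2l leq_exp2l // leqnSn !orbT.
exists (H 0) => // a aA fb nz z zr0.
set f := dirichlet_poly m a in fb nz *.
have err k w : normc w <= rho1 ->
    normc (f w - (taylor_poly m a (4 * n k)).[w]) < H k.+1.
  move=> wr; apply: le_lt_trans (taylor_poly_error m a _ wr) _.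
  apply: le_lt_trans (HD k.+1 (n k.+1) erefl).
  (* The Taylor degree 4 n_k equals 2 n_(k+1), so the degree choice at k + 1 bounds the error by
     H_(k+1). *)
  have -> : (2 * n k.+1 = 4 * n k)%N by rewrite /n expnS (mulnCA D) mulnA.
  rewrite -/L [L ^+ _ * expR L]mulrC -[expR L * _ / _]mulrA [_ * (expR L * _)]mulrA.
  rewrite ler_pM ?mulr_ge0 ?sumr_ge0 ?expR_ge0 ?invr_ge0 ?exprn_ge0 //.
  - by move=> j _; exact: normc_ge0.
  - by rewrite ler_wpM2r ?expR_ge0 // (le_trans aA) // (le_trans (ler_norm A)) // lerDl.
  rewrite ler_wpM2r ?invr_ge0 // lerXn2r ?nnegrE ?addr_ge0 // lerDl //.
have nzn k : (0 < 4 * n k)%N by rewrite muln_gt0 n0.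
have step k w : normc w <= r k -> normc (f w) < H k ->
    exists2 v, normc v <= r k.+1 & normc (f v) < H k.+1.
  move=> wr fw; set T := taylor_poly m a (4 * n k).
  have [[v rv vr]|nroot] := pselect (exists2 v, root T v & normc v <= r k.+1).
    exists v => //; have := err k v (le_trans vr (ltW (rho1r _))).
    by rewrite -/T (rootP rv) subr0.
  exfalso; have gi1 : 1 <= (g k)^-1.
    by rewrite invf_ge1 // (le_trans (g1 _)) // ltW.
  have sT : (size T <= (4 * n k).+1)%N by rewrite (leq_trans (size_poly _ _)).
  have ratio v : root T v -> normc (0 - v) <= (g k)^-1 * normc (w - v).
    move=> rv; rewrite sub0r normcN mulrC ler_pdivlMr //.
    have vr : r k.+1 < normc v.
      by rewrite ltNge; apply/negP => vr; apply: nroot; exists v.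
    (* |v| (1 - g_k) >= r_(k+1) (1 - g_k) >= r_k >= |w|, because r_(k+1) = r_k + rho1 g_k and
       r_(k+1) < rho1. *)
    rewrite normc_distC; apply: le_trans (normcB_ge v w).
    rewrite rS in vr; have := rho1r k.+1; rewrite rS.
    have := g0 k; have := g1 k; move: (g k) vr => gk; nra.
  have := poly_ratio gi1 sT ratio.
  have -> : T.[0] = f 0 by rewrite /T -(prednK (nzn k)) taylor_poly0.
  rewrite exprVn mulrC.
  rewrite ler_pdivlMr ?exprn_gt0 // => fT.
  have : normc T.[w] < 2 * H k.
    have -> : T.[w] = f w - (f w - T.[w]) by rewrite opprB addrC subrK.
    apply: le_lt_trans (normcB _ _) _.
    have := err k w (le_trans wr (ltW (rho1r _))); rewrite -/T.
    have := HS k; lra.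
  have : beta * g k ^+ (4 * n k) <= normc (f 0) * g k ^+ (4 * n k).
    by rewrite ler_wpM2r ?exprn_ge0 ?(ltW (g0 _)).
  have -> : 2 * H k = beta * g k ^+ (4 * n k) by rewrite /H; field.
  lra.
rewrite leNgt; apply/negP => fz.
have seq k : exists2 v, normc v <= r k & normc (f v) < H k.
  elim: k => [|k [v vr fv]]; last exact: step fv.
  exists z => //; rewrite (le_trans zr0) // /r expr0; lra.
have [mu mu0 Hmu] := dirichlet_min_square (ltW r1) nz.
have Hc k : H k <= beta / 2 * c ^+ k.
  rewrite /H ler_wpM2l ?divr_ge0 ?(ltW b0) //.
  apply: (@le_trans _ _ (c ^+ (4 * n k))).
    by rewrite lerXn2r ?nnegrE ?(ltW (g0 _)) ?(ltW c0).
  rewrite ler_wiXn2l ?(ltW c0) ?(ltW c1) // /n.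
  rewrite (leq_trans (ltnW (ltn_expl k (ltnSn 1)))) // mulnA leq_pmull //.
  by rewrite muln_gt0 D0.
have : (beta / 2 * c ^+ k) @[k --> \oo] --> 0.
  rewrite -[X in _ --> X](mulr0 (beta / 2)).
  by apply: cvgMr; apply: cvg_expr; rewrite ger0_norm ?(ltW c0).
move=> /cvgrPdist_lt /(_ mu mu0) [K _ /(_ K (leqnn K))] /=.
rewrite sub0r normrN ger0_norm ?mulr_ge0 ?divr_ge0 ?exprn_ge0 ?(ltW c0) ?(ltW b0) // => cmu.
have [v vr fv] := seq K.
have Rv : `|Re v| <= normc v /\ `|Im v| <= normc v.
  case: (v) => x y /=; split; rewrite -sqrtr_sqr ler_wsqrtr // ?lerDl ?lerDr sqr_ge0 //.
have vr1 := le_trans vr (ltW (rho1r K)).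
have := Hmu v (le_trans Rv.1 vr1) (le_trans Rv.2 vr1); rewrite -/f.
have := Hc K; lra.
Qed.

End LowerBound.

Section LowerBound.
Variable R : realType.
Implicit Types (s z w : R[i]).

Lemma powR_natN_le1 (k : nat) (x : R) : (0 < k)%N -> 0 <= x -> k%:R `^ (- x) <= 1 :> R.
Proof.
move=> k0 x0; rewrite -[leRHS](powRr0 (k%:R : R)) ler_powR ?oppr_le0 // ler1n //.
Qed.

(** Far to the right the term j = 1 dominates: the others contribute at most A / 2^K, and 2^K >= K >
    2 A / |p_1|. *)
Lemma dirichlet_far_right m (p : nat -> R[i]) : (0 < m)%N -> p 1%N != 0 ->
  exists K : R, forall s, K <= Re s -> normc (p 1%N) / 2 <= normc (dirichlet_poly m p s).
Proof.
move=> m0 p1; have np1 : 0 < normc (p 1%N) by rewrite normc_gt0.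
pose A := \sum_(1 <= j < m.+1) normc (p j).
have A0 : 0 <= A by rewrite sumr_ge0 // => j _; exact: normc_ge0.
pose K := Num.bound (2 * A / normc (p 1%N)).
have KA : 2 * A / normc (p 1%N) < K%:R.
  by rewrite archi_boundP // divr_ge0 ?mulr_ge0 ?normc_ge0.
exists K%:R => s Ks.
have s0 : 0 <= Re s by rewrite (le_trans _ Ks).
suff : normc (dirichlet_poly m p s - p 1%N) <= normc (p 1%N) / 2.
  by move=> H; have := normcB_ge (p 1%N) (p 1%N - dirichlet_poly m p s);
     rewrite subKr normc_distC; lra.
rewrite /dirichlet_poly big_ltn // natpowC1 mulr1 addrAC subrr add0r.
apply: (le_trans (normc_sum _ _ _)).
apply: (@le_trans _ _ (A / 2 ^+ K)).
  rewrite /A (@big_ltn _ _ _ 1) // mulrDl mulr_suml ler_wpDl //.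
    by rewrite divr_ge0 ?normc_ge0 ?exprn_ge0.
  rewrite !big_nat; apply: ler_sum => j /andP[j2 jm].
  rewrite normcM ler_wpM2l ?normc_ge0 // normc_natpowC ?(ltn_trans _ j2) // ReN.
  have j0 : 0 < j%:R :> R by rewrite ltr0n (ltn_trans _ j2).
  apply: (@le_trans _ _ (j%:R `^ (- K%:R))).
    by rewrite ler_powR ?lerN2 // ler1n -(ltr0n R).
  rewrite powRN powR_mulrn ?(ltW j0) // lef_pV2 ?posrE ?exprn_gt0 //.
  by rewrite lerXn2r ?nnegrE ?(ltW j0) // ler_nat.
rewrite ler_pdivrMr ?exprn_gt0 // mulrAC ler_pdivlMr //.
move: KA; rewrite ltr_pdivrMr // => KA.
have : K%:R <= 2 ^+ K :> R by rewrite -natrX ler_nat ltnW // ltn_expl.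
have := ltW np1; move: (2 ^+ K) => X; nra.
Qed.

(** Twisting the coefficients by j^-c moves the centre c = S + i Im s to 0 and does not increase
    their moduli, so one disc estimate serves all heights Im s. Beyond Re s = K the first term
    dominates. *)
Lemma dirichlet_lower_bound m (p : nat -> R[i]) (sigma : R) :
  (0 < m)%N -> p 1%N != 0 -> (forall s, 0 < Re s -> dirichlet_poly m p s != 0) ->
  0 < sigma ->
  exists2 delta : R, 0 < delta &
    forall s, sigma <= Re s -> delta <= normc (dirichlet_poly m p s).
Proof.
move=> m0 p1 nz s0; have np1 : 0 < normc (p 1%N) by rewrite normc_gt0.
have [K KP] := dirichlet_far_right m0 p1.
pose A := \sum_(1 <= j < m.+1) normc (p j).
pose S := Num.max K (sigma + 1).
have SK : K <= S by rewrite le_max lexx.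
have Ss : sigma + 1 <= S by rewrite le_max lexx orbT.
(* Around a centre of abscissa S the inner disc reaches Re s = sigma, and the outer square stays in
   Re s >= sigma / 2, inside the zero-free region. *)
have [||| delta d0 Hd] := @dirichlet_lower_bound_disc R m A
    (normc (p 1%N) / 2) (S - sigma) (S - sigma / 2); [lra..|].
exists (Num.min delta (normc (p 1%N) / 2)).
  by rewrite lt_min d0 divr_gt0.
move=> s sr; rewrite ge_min.
have [Ks|sS] := leP K (Re s); first by rewrite KP // orbT.
apply/orP; left; pose c : R[i] := S +i* Im s.
have cS : Re c = S by [].
have -> : s = c + (s - c) by rewrite addrC subrK.
rewrite dirichlet_polyD; apply: Hd.
- rewrite /A !big_nat; apply: ler_sum => j /andP[j0 _].
  rewrite normcM normc_natpowC // ReN cS ler_piMl ?normc_ge0 //.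
  by rewrite powR_natN_le1 //; lra.
- by rewrite -dirichlet_polyD addr0 KP // cS.
- by move=> z zr zi; rewrite -dirichlet_polyD nz // ReD cS; move: zr; rewrite ler_norml; lra.
have -> : s - c = (Re s - S)%:C.
  by apply/eqP; rewrite eq_complex ReB ImD ImN /= subrr !eqxx.
by rewrite normc_real ler_norml; lra.
Qed.

End LowerBound.

(** * The Dirichlet inverse *)

Definition smooth (m n : nat) : bool := all (fun q => (q <= m)%N) (primes n).

(** Prime factors up to m counted with multiplicity: [logn q n] is 0 when q is not prime. For smooth
    n this is the usual Omega(n). *)
Definition Omega (m n : nat) : nat := (\sum_(q < m.+1) logn q n)%N.

Lemma OmegaM m j k : (0 < j)%N -> (0 < k)%N ->
  Omega m (j * k) = (Omega m j + Omega m k)%N.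
Proof.
by move=> j0 k0; rewrite /Omega -big_split; apply: eq_bigr => q _; rewrite lognM.
Qed.

Lemma Omega1 m : Omega m 1 = 0%N.
Proof. by rewrite /Omega big1 // => q _; rewrite logn1. Qed.

Lemma Omega_gt0 m n q : (q <= m)%N -> (0 < n)%N -> prime q -> (q %| n)%N ->
  (0 < Omega m n)%N.
Proof.
move=> qm n0 qp qn; rewrite -ltnS in qm.
rewrite /Omega (bigD1 (Ordinal qm)) //= addn_gt0 logn_gt0.
by rewrite mem_primes qp n0 qn.
Qed.

Lemma smoothM m j k : (0 < j)%N -> (0 < k)%N ->
  smooth m (j * k) = smooth m j && smooth m k.
Proof.
move=> j0 k0; apply/allP/andP => [H|[/allP Hj /allP Hk] q].
  by split; apply/allP => q qj; apply: H; rewrite primesM // qj ?orbT.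
by rewrite primesM // => /orP[/Hj|/Hk].
Qed.

Lemma smooth_leq m j : (0 < j)%N -> (j <= m)%N -> smooth m j.
Proof.
move=> j0 jm; apply/allP => q; rewrite mem_primes => /and3P[_ _ qj].
by rewrite (leq_trans (dvdn_leq j0 qj)).
Qed.

(** A smooth n is a product of Omega(n) primes, each at most m; the induction splits off the least
    one. *)
Lemma smooth_leq_exp m n : (0 < n)%N -> smooth m n -> (n <= m ^ Omega m n)%N.
Proof.
elim/ltn_ind: n => n IH n0 sn.
have [n1|n1] := leqP n 1.
  have -> : n = 1%N by apply/eqP; rewrite eqn_leq n1.
  by rewrite Omega1 expn0.
have qp := pdiv_prime n1; have qn := pdiv_dvd n.
have qm : (pdiv n <= m)%N.
  by apply: (allP sn); rewrite mem_primes qp n0 qn.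
have q0 := prime_gt0 qp.
have k0 : (0 < n %/ pdiv n)%N by rewrite divn_gt0 // dvdn_leq.
have kn : (n %/ pdiv n < n)%N by rewrite ltn_Pdiv ?prime_gt1.
have nE : (pdiv n * (n %/ pdiv n))%N = n by rewrite mulnC divnK.
move: (pdiv n) (n %/ pdiv n)%N qp qm q0 k0 kn nE {qn} => q k qp qm q0 k0 kn nE.
rewrite -nE in sn *; rewrite smoothM // in sn; have /andP[_ sk] := sn.
rewrite OmegaM // expnD; apply: leq_mul; last exact: IH.
rewrite (leq_trans qm) // -{1}[m]expn1 leq_pexp2l ?(leq_trans q0 qm) //.
exact: (Omega_gt0 qm q0 qp (dvdnn q)).
Qed.

(** * Euler product bound for sums over smooth numbers *)

Section Euler.
Variable R : realType.

(* Expanding the product over q <= m of the geometric series in x. *)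
Lemma smooth_sum_le (x : R) m N : 0 <= x -> x < 1 ->
  \sum_(1 <= n < N.+1 | smooth m n) x ^+ Omega m n <= ((1 - x)^-1) ^+ m.+1.
Proof.
move=> x0 x1.
have geo n : \sum_(i < n) x ^+ i <= (1 - x)^-1.
  rewrite -[leRHS]mul1r ler_pdivlMr ?subr_gt0 //.
  suff -> : (\sum_(i < n) x ^+ i) * (1 - x) = 1 - x ^+ n.
    by rewrite gerBl exprn_ge0.
  elim: n => [|n IH]; first by rewrite big_ord0 mul0r expr0 subrr.
  by rewrite big_ord_recr /= mulrDl IH exprS; ring.
(* The exponent vector determines a smooth n, and all exponents are below n, so [inord] never falls
   back to its default. *)
pose e (n : 'I_N.+1) : {ffun 'I_m.+1 -> 'I_N.+1} :=
  [ffun q : 'I_m.+1 => inord (logn q n)].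
pose h (f : {ffun 'I_m.+1 -> 'I_N.+1}) : R := \prod_q x ^+ (f q).
pose A := [set n : 'I_N.+1 | (0 < n)%N && smooth m n]%SET.
have eE (n : 'I_N.+1) q : (0 < n)%N -> e n q = logn q n :> nat.
  move=> n0; rewrite ffunE inordK // ltnS.
  by rewrite (leq_trans (ltnW (ltn_logl _ n0))) // -ltnS.
have -> : \sum_(1 <= n < N.+1 | smooth m n) x ^+ Omega m n =
    \sum_(n in A) h (e n).
  rewrite big_geq_mkord; apply: eq_big => [n|n /andP[_ n0]].
    by rewrite inE andbC.
  by rewrite /h /Omega expr_sum; apply: eq_bigr => q _; rewrite eE.
have injA : {in A &, injective e}.
  move=> n k; rewrite !inE => /andP[n0 /allP sn] /andP[k0 /allP sk] /ffunP enk.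
  apply/val_inj/eqn_from_log => // q.
  have [qm|mq] := leqP q m.
    by have := enk (Ordinal (qm : (q < m.+1)%N)) => /(congr1 val) /=; rewrite !eE.
  have noq (l : nat) : (forall q, q \in primes l -> (q <= m)%N) -> logn q l = 0%N.
    by move=> sl; apply/eqP; rewrite eqn0Ngt logn_gt0; apply: contraL mq => /sl; rewrite leqNgt.
  by rewrite !noq.
rewrite -(big_imset h injA) /=.
apply: (@le_trans _ _ (\sum_f h f)).
  by rewrite [leRHS](bigID (mem (e @: A))) /= lerDl sumr_ge0 // => f _;
     rewrite prodr_ge0 // => q _; rewrite exprn_ge0.
rewrite /h -(bigA_distr_bigA (fun (_ : 'I_m.+1) (j : 'I_N.+1) => x ^+ j)) /=.
rewrite prodr_const card_ord lerXn2r ?nnegrE ?sumr_ge0 ?invr_ge0 ?subr_ge0 ?(ltW x1) //.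
  by move=> i _; rewrite exprn_ge0.
exact: geo.
Qed.

End Euler.

Section DirichletInverse.
Variable F : fieldType.
Variables (m : nat) (p : nat -> F).

(* The argument [fuel] bounds the depth of the recursion c(n) -> c(n / j). *)
Fixpoint dinv_rec (fuel n : nat) : F :=
  if fuel is fuel'.+1 then
    (p 1%N)^-1 * ((n == 1%N)%:R
      - \sum_(2 <= j < m.+1 | (j %| n)%N) p j * dinv_rec fuel' (n %/ j))
  else 0.

Definition dinv (n : nat) : F := dinv_rec n n.

Lemma dinv_rec_fuel f1 f2 n : (0 < n)%N -> (n <= f1)%N -> (n <= f2)%N ->
  dinv_rec f1 n = dinv_rec f2 n.
Proof.
elim: f1 f2 n => [|f1 IH] [|f2] n; rewrite ?leqn0 => n0 n1 n2; try by lia.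
rewrite /=; congr (_ * (_ - _)); rewrite big_nat_cond [RHS]big_nat_cond.
apply: eq_bigr => j /andP[/andP[j2 _] jn]; congr (_ * _).
have nj : (n %/ j < n)%N by rewrite ltn_Pdiv.
by apply: IH; [rewrite divn_gt0 ?(dvdn_leq n0) // ltnW|lia..].
Qed.

Lemma dinvE n : (0 < n)%N ->
  dinv n = (p 1%N)^-1 * ((n == 1%N)%:R
    - \sum_(2 <= j < m.+1 | (j %| n)%N) p j * dinv (n %/ j)).
Proof.
rewrite /dinv; case: n => // n n0 /=; congr (_ * (_ - _)).
rewrite big_nat_cond [RHS]big_nat_cond.
apply: eq_bigr => j /andP[/andP[j2 _] jn]; congr (_ * _).
have nj : (n.+1 %/ j < n.+1)%N by rewrite ltn_Pdiv.
by apply: dinv_rec_fuel; [rewrite divn_gt0 ?(dvdn_leq n0) // ltnW|lia|lia].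
Qed.

Lemma dconv_dinv n : (0 < m)%N -> p 1%N != 0 -> (0 < n)%N ->
  dconv m p dinv n = (n == 1%N)%:R.
Proof.
move=> m0 p1 n0; rewrite /dconv big_ltn_cond // dvd1n divn1 {1}dinvE //.
by rewrite mulrA divff // mul1r subrK.
Qed.

(** By the recursion a nonzero value at n > 1 requires one at some n / j with 2 <= j <= m, and such
    a j has only prime factors up to m. *)
Lemma dinv_smooth n : (0 < n)%N -> dinv n != 0 -> smooth m n.
Proof.
elim/ltn_ind: n => n IH n0 cn.
have [n1|n1] := leqP n 1.
  by have -> : n = 1%N by apply/eqP; rewrite eqn_leq n1.
have [[j [j2 jm jn cj]]|H] := pselect (exists j, [/\ (1 < j)%N, (j <= m)%N,
    (j %| n)%N & dinv (n %/ j) != 0]).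
  have nj : (n %/ j < n)%N by rewrite ltn_Pdiv.
  have nj0 : (0 < n %/ j)%N by rewrite divn_gt0 ?(dvdn_leq n0) // ltnW.
  by rewrite -(divnK jn) smoothM ?(ltnW j2) // IH // smooth_leq // ltnW.
move/eqP: cn; case; rewrite dinvE // gtn_eqF // big_nat_cond big1 ?subrr ?mulr0 //.
move=> j /andP[/andP[j2 jm] jn]; apply/eqP; rewrite mulf_eq0; apply/orP; right.
by apply/negPn/negP => cj; apply: H; exists j.
Qed.

End DirichletInverse.

Section InverseGrowth.
Variables (R : realType) (m : nat) (p : nat -> R[i]).

(** The recursion passes from n to n / j <= n / 2, which gains a factor 2^-K, and K is chosen with A
    / |p_1| <= 2^K. This crude bound starts the descent in sigma. *)
Lemma dinv_growth : p 1%N != 0 -> exists K : nat, forall n, (0 < n)%N ->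
  normc (dinv m p n) <= (normc (p 1%N))^-1 * n%:R ^+ K.
Proof.
move=> p1; have np1 : 0 < normc (p 1%N) by rewrite normc_gt0.
pose A := \sum_(2 <= j < m.+1) normc (p j).
have A0 : 0 <= A by rewrite sumr_ge0 // => j _; exact: normc_ge0.
pose K := Num.bound (A / normc (p 1%N)).
have KA : A / normc (p 1%N) < K%:R by rewrite archi_boundP // divr_ge0 ?normc_ge0.
have K2 : K%:R <= 2 ^+ K :> R by rewrite -natrX ler_nat ltnW // ltn_expl.
exists K => n; elim/ltn_ind: n => n IH n0.
have c0 : 0 <= (normc (p 1%N))^-1 by rewrite invr_ge0 ltW.
rewrite dinvE // normcM normcV ler_wpM2l //.
have [n1|n1] := leqP n 1.
  have -> : n = 1%N by apply/eqP; rewrite eqn_leq n1.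
  rewrite big_nat_cond big1; last first.
    by move=> j /andP[/andP[j2 _]]; rewrite dvdn1 => /eqP j1; move: j2; rewrite j1.
  by rewrite subr0 normc1 expr1n.
rewrite gtn_eqF // sub0r normcN.
apply: (le_trans (normc_sum _ _ _)).
apply: (@le_trans _ _ (\sum_(2 <= j < m.+1)
    normc (p j) * ((normc (p 1%N))^-1 * (n%:R / 2) ^+ K))).
  rewrite big_mkcond !big_nat; apply: ler_sum => j /andP[j2 jm].
  case: ifP => [jn|_]; last by rewrite !mulr_ge0 ?normc_ge0 ?exprn_ge0 ?divr_ge0.
  have nj : (n %/ j < n)%N by rewrite ltn_Pdiv.
  have nj0 : (0 < n %/ j)%N by rewrite divn_gt0 ?(dvdn_leq n0) // ltnW.
  rewrite normcM ler_wpM2l ?normc_ge0 // (le_trans (IH _ nj nj0)) // ler_wpM2l //.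
  rewrite lerXn2r ?nnegrE ?divr_ge0 // ler_pdivlMr // -natrM ler_nat.
  by rewrite -{2}(divnK jn) leq_mul2l j2 orbT.
rewrite -mulr_suml -/A mulrA expr_div_n mulrCA ler_piMr ?exprn_ge0 //.
rewrite ler_pdivrMr ?exprn_gt0 // mul1r (le_trans (ltW KA)) //.
Qed.

End InverseGrowth.

Section Sequences.
Variable R : realType.

Lemma ge0_geometric_le0 (b C x : R) : 0 <= x -> x < 1 ->
  (forall j : nat, b <= C * x ^+ j) -> b <= 0.
Proof.
move=> x0 x1 H; rewrite leNgt; apply/negP => b0.
have : (C * x ^+ k) @[k --> \oo] --> 0.
  rewrite -[X in _ --> X](mulr0 C).
  by apply: cvgMr; apply: cvg_expr; rewrite ger0_norm.
move=> /cvgrPdist_lt /(_ b b0) [K _ /(_ K (leqnn K))] /=.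
rewrite sub0r normrN => cb.
by have := lt_le_trans cb (H K); rewrite ltNge ler_norm.
Qed.

(* The recursion forces exponential growth at rate K / (K - d) as soon as some
   term exceeds 1 / d. *)
Lemma bounded_of_slow_growth (A : nat -> R) (d K C theta : R) :
  0 < d -> d < K -> 0 <= theta -> theta * (K - d) < K ->
  (forall k, d * A k.+1 <= 1 + K * (A k.+1 - A k)) ->
  (forall k, A k <= C * theta ^+ k) -> forall k, A k <= d^-1.
Proof.
move=> d0 dK t0 tK rec growth k; rewrite -subr_le0.
pose B k := A k - d^-1; rewrite -/(B k).
pose y := (K - d) / K.
have K0 : 0 < K by rewrite (lt_trans d0).
have y0 : 0 <= y by rewrite divr_ge0 ?subr_ge0 ?ltW.
have recB j : B j <= y * B j.+1.
  rewrite /y mulrAC ler_pdivlMr // /B.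
  have := rec j; have : d * d^-1 = 1 by rewrite divff // gt_eqF.
  by move: (A j) (A j.+1) (d^-1) => a b e; nra.
have recBj j : B k <= y ^+ j * B (k + j)%N.
  elim: j => [|j IH]; first by rewrite expr0 mul1r addn0.
  rewrite (le_trans IH) // exprSr -mulrA ler_wpM2l ?exprn_ge0 //.
  by rewrite addnS recB.
have ty : theta * y < 1 by rewrite /y mulrA ltr_pdivrMr // mul1r.
clearbody y; apply: (@ge0_geometric_le0 _ (C * theta ^+ k) (theta * y)) => //.
  by rewrite mulr_ge0.
move=> j; rewrite (le_trans (recBj j)) // exprMn mulrA [leRHS]mulrC.
rewrite ler_wpM2l ?exprn_ge0 // -mulrA -exprD.
by rewrite (le_trans _ (growth _)) // /B gerBl invr_ge0 ltW.
Qed.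

Lemma sum_inv_sqr_le N : \sum_(1 <= n < N.+1) (n%:R ^- 2) <= 2 :> R.
Proof.
case: N => [|N]; first by rewrite big_geq.
suff : \sum_(1 <= n < N.+2) (n%:R ^- 2) <= 2 - N.+1%:R^-1 :> R.
  by move=> H; rewrite (le_trans H) // gerBl invr_ge0.
elim: N => [|N IH]; first by rewrite big_nat1 invr1 expr1n invr1; lra.
rewrite big_nat_recr //=; apply: le_trans (lerD IH (lexx _)) _.
have a0 : 0 < N.+1%:R :> R by rewrite ltr0n.
have -> : N.+2%:R = N.+1%:R + 1 :> R by rewrite -natr1.
move: (N.+1%:R) a0 => a a0.
have -> : 2 - a^-1 + (a + 1) ^- 2 = 2 - (a + 1)^-1 - (a * (a + 1) ^+ 2)^-1.
  by field; rewrite ?gt_eqF //; lra.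
by rewrite gerBl invr_ge0 mulr_ge0 ?exprn_ge0 //; lra.
Qed.

Lemma sqr_normc_sum_le (I : Type) (r : seq I) (P : pred I) (F : I -> R[i]) :
  normc (\sum_(i <- r | P i) F i) ^+ 2 <=
  2 ^+ size r * \sum_(i <- r | P i) normc (F i) ^+ 2.
Proof.
elim: r => [|i r IH]; first by rewrite !big_nil normc0 expr0n mulr0.
have S0 : 0 <= \sum_(i <- r | P i) normc (F i) ^+ 2.
  by rewrite sumr_ge0 // => j _; rewrite sqr_ge0.
have p1 : 1 <= 2 ^+ size r :> R by rewrite exprn_ege1 // ler1n.
rewrite !big_cons /= [2 ^+ _.+1]exprS; case: (P i).
  rewrite (le_trans (sqr_normcD_le _ _)) //.
  set S := \sum_(j <- r | P j) normc _ ^+ 2 in IH S0 *; set T := 2 ^+ size r in IH p1 *.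
  have x0 := sqr_ge0 (normc (F i)).
  move: (normc (F i) ^+ 2) (normc _ ^+ 2) x0 IH => x u x0 IH.
  clearbody S T; nra.
rewrite (le_trans IH) // -mulrA; set x := 2 ^+ _ * _ in IH *.
have x0 : 0 <= x by rewrite mulr_ge0 // (le_trans ler01).
by clearbody x; lra.
Qed.

Lemma bernoulli_sub (r : R) k : 0 <= r -> r <= 1 -> 1 - r ^+ k <= k%:R * (1 - r).
Proof.
move=> r0 r1; elim: k => [|k IH]; first by rewrite expr0 subrr mul0r.
have x1 : r ^+ k <= 1 by rewrite exprn_ile1.
rewrite exprS -natr1; have := exprn_ge0 k r0.
by move: (r ^+ k) (k%:R) IH x1 => x y; nra.
Qed.

End Sequences.

(** * Mean squares of the inverse on vertical lines *)

Section Energy.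
Variables (R : realType) (m : nat) (p : nat -> R[i]).
Hypothesis m0 : (0 < m)%N.
Hypothesis p1 : p 1%N != 0.
Let c := dinv m p.

(** By Parseval, the mean square on Re s = sigma of the partial sum of 1/Q up to N. *)
Definition dinv_energy (sigma : R) (N : nat) : R :=
  \sum_(1 <= n < N.+1) (normc (dinv m p n) * n%:R `^ (- sigma)) ^+ 2.

Let K : R := 2 ^+ m * \sum_(1 <= j < m.+1) normc (p j) ^+ 2.

(* Parseval applied to p times the truncated inverse: the product is 1 up to
   terms that only involve the coefficients of index above N / m. *)
Lemma dinv_energy_recursion sigma delta k : 0 <= sigma -> 0 < delta ->
  (forall s, sigma = Re s -> delta <= normc (dirichlet_poly m p s)) ->
  delta ^+ 2 * dinv_energy sigma (m.+1 ^ k.+1) <=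
  1 + K * (dinv_energy sigma (m.+1 ^ k.+1) - dinv_energy sigma (m.+1 ^ k)).
Proof.
move=> s0 d0 Hd; set N := (m.+1 ^ k.+1)%N; set N' := (m.+1 ^ k)%N.
have N1 : (0 < N)%N by rewrite expn_gt0.
have NE : N = (m.+1 * N')%N by rewrite /N expnS.
pose u n : R[i] := natpowC n (- sigma%:C).
have uM j l : (0 < j)%N -> (0 < l)%N -> u (j * l)%N = u j * u l.
  by move=> *; rewrite /u natpowCM.
have nu n : (0 < n)%N -> normc (u n) = n%:R `^ (- sigma).
  by move=> n0; rewrite /u normc_natpowC // ReN.
pose y n := if (n <= N)%N then u n * c n else 0.
have y0 n : (N < n)%N -> y n = 0 by rewrite /y ltnNge => /negbTE ->.
have yE n : (0 < n <= N)%N -> normc (y n) ^+ 2 = (normc (c n) * n%:R `^ (- sigma)) ^+ 2.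
  by move=> /andP[n0 nN]; rewrite /y nN normcM nu // mulrC.
pose X := (m * N)%N.
have NX : (N <= X)%N by rewrite leq_pmull.
pose ps j := u j * p j.
(* On the line delta |D| <= |Q D|, where D is the truncated inverse; both sides are padded to the
   length m N of the product. *)
have key : \sum_(1 <= n < X.+1) normc (delta%:C * y n) ^+ 2 <=
    \sum_(1 <= n < X.+1) normc (dconv m ps y n) ^+ 2.
  apply: parseval_le => t; rewrite -dirichlet_polyM //.
  have -> : dirichlet_poly X (fun n => delta%:C * y n) (0 +i* t) =
      delta%:C * dirichlet_poly N y (0 +i* t).
    rewrite -(dirichlet_poly_trunc _ NX) // /dirichlet_poly mulr_sumr.
    by apply: eq_bigr => n _ /=; rewrite -mulrA.
  rewrite !normcM ler_wpM2r ?normc_ge0 // normc_real gtr0_norm //.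
  by rewrite -dirichlet_polyD Hd // ReD /= addr0.
have lhs : \sum_(1 <= n < X.+1) normc (delta%:C * y n) ^+ 2 =
    delta ^+ 2 * dinv_energy sigma N.
  rewrite (@big_cat_nat _ _ _ N.+1) //= [X in _ + X]big_nat.
  rewrite [X in _ + X]big1 ?addr0; last first.
    by move=> n /andP[Nn _]; rewrite y0 // mulr0 normc0 expr0n.
  rewrite /dinv_energy mulr_sumr; apply: eq_big_nat => n nN.
  by rewrite normcM exprMn yE // normc_real gtr0_norm.
rewrite -lhs (le_trans key) // (@big_cat_nat _ _ _ N.+1) //=; apply: lerD.
  rewrite big_ltn // big_nat big1 ?addr0 => [|n /andP[n1 nN]]; last first.
    have n0 : (0 < n)%N by rewrite ltnW.
    rewrite (eq_dconv (q := ps) (z := fun l => u l * c l)) //.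
      by rewrite dconv_twist // dconv_dinv // gtn_eqF // mulr0 normc0 expr0n.
    by move=> l /andP[_ ln]; rewrite /y (leq_trans ln).
  rewrite (eq_dconv (q := ps) (z := fun l => u l * c l)) //.
    by rewrite dconv_twist // dconv_dinv // /u natpowC1 mulr1 normc1 expr1n.
  by move=> l /andP[_ ln]; rewrite /y (leq_trans ln).
apply: (@le_trans _ _ (\sum_(N.+1 <= n < X.+1) 2 ^+ m *
    dconv m (fun j => normc (p j) ^+ 2) (fun l => normc (y l) ^+ 2) n)).
  rewrite !big_nat; apply: ler_sum => n /andP[Nn nX].
  rewrite (le_trans (sqr_normc_sum_le _ _ _)) // size_iota subSS subn0.
  rewrite ler_wpM2l ?exprn_ge0 // /dconv big_nat_cond [leRHS]big_nat_cond.
  apply: ler_sum => j /andP[/andP[j0 _] _].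
  rewrite normcM exprMn ler_wpM2r ?sqr_ge0 //.
  rewrite lerXn2r ?nnegrE ?normc_ge0 // normcM.
  by rewrite nu // ler_piMl ?normc_ge0 // powR_natN_le1.
rewrite -mulr_sumr /K -mulrA ler_wpM2l ?exprn_ge0 //.
apply: (le_trans (sum_dconv_tail_le _ _ _ _)) => [j|l|l Nl|].
- exact: sqr_ge0.
- exact: sqr_ge0.
- by rewrite y0 // normc0 expr0n.
rewrite ler_wpM2l ?sumr_ge0 // => [j _|]; first exact: sqr_ge0.
rewrite /dinv_energy [in leRHS](@big_cat_nat _ _ _ N'.+1 1 N.+1) //=; last first.
  by rewrite NE ltnS leq_pmull.
rewrite [leRHS]addrAC subrr add0r (@big_cat_nat _ _ _ N'.+1 1 N.+1) //=; last first.
  by rewrite NE ltnS leq_pmull.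
(* m l > N = (m + 1) N' forces l > N'. The base m + 1 also lets the cutoffs grow when m = 1. *)
rewrite big_nat_cond big1 ?add0r => [|l /andP[/andP[l0 lN] ml]]; last first.
  by move: ml; rewrite ltnNge NE leq_mul // ltnW.
rewrite big_mkcond [leRHS]big_nat big_nat; apply: ler_sum => l /andP[Nl lN].
rewrite -yE ?(leq_ltn_trans _ Nl) //; case: ifP => // _; exact: sqr_ge0.
Qed.

End Energy.

Section Subpolynomial.
Variables (R : realType) (m : nat) (p : nat -> R[i]).
Hypothesis m0 : (0 < m)%N.
Hypothesis p1 : p 1%N != 0.
Let E := dinv_energy m p.

Lemma dinv_energy_le sigma tau N : sigma <= tau -> E tau N <= E sigma N.
Proof.
move=> st; rewrite /E /dinv_energy !big_nat; apply: ler_sum => n /andP[n0 _].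
rewrite lerXn2r ?nnegrE ?mulr_ge0 ?normc_ge0 ?powR_ge0 //.
by rewrite ler_wpM2l ?normc_ge0 // ler_powR ?lerN2 // ler1n.
Qed.

(** With growth exponent K, the line sigma = K + 1 makes the summands O(n^-2). *)
Lemma dinv_energy_far : exists sigma C : R, 0 <= sigma /\ forall N, E sigma N <= C.
Proof.
have [K HK] := dinv_growth m p1.
exists K.+1%:R, ((normc (p 1%N))^-1 ^+ 2 * 2); split=> // N.
apply: le_trans (ler_wpM2l (sqr_ge0 _) (sum_inv_sqr_le R N)).
rewrite /E /dinv_energy mulr_sumr !big_nat; apply: ler_sum => n /andP[n0 _].
have n0R : 0 < n%:R :> R by rewrite ltr0n.
rewrite -exprVn -exprMn lerXn2r ?nnegrE ?mulr_ge0 ?normc_ge0 ?powR_ge0 ?invr_ge0 ?normc_ge0 //.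
rewrite powRN powR_mulrn // ler_pdivrMr ?exprn_gt0 //.
rewrite (le_trans (HK n n0)) // -mulrA ler_wpM2l ?invr_ge0 ?normc_ge0 //.
by rewrite exprS mulrA mulVf ?mul1r // gt_eqF.
Qed.

(** Moving left by eta costs n^(2 eta) <= (m + 1)^(2 eta k) in each term: a bound on the line sigma
    + eta becomes geometric growth in k on the line sigma. *)
Lemma dinv_energy_shift sigma eta k : 0 <= eta ->
  E sigma (m.+1 ^ k) <= E (sigma + eta) (m.+1 ^ k) * (m.+1%:R `^ (2 * eta)) ^+ k.
Proof.
move=> e0; rewrite /E /dinv_energy mulr_suml !big_nat.
apply: ler_sum => n /andP[n0 nk].
have -> : (m.+1%:R `^ (2 * eta)) ^+ k = (((m.+1 ^ k)%N)%:R `^ eta) ^+ 2 :> R.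
  have -> : (m.+1 ^ k)%:R = m.+1%:R `^ k%:R :> R by rewrite natrX powR_mulrn.
  rewrite -(powR_mulrn k (powR_ge0 _ _)) -(powR_mulrn 2 (powR_ge0 _ _)) -!powRrM.
  by congr (_ `^ _); ring.
rewrite -exprMn lerXn2r ?nnegrE ?mulr_ge0 ?normc_ge0 ?powR_ge0 //.
rewrite -mulrA ler_wpM2l ?normc_ge0 //.
have -> : - sigma = - (sigma + eta) + eta by ring.
rewrite powRD; last by rewrite pnatr_eq0 -lt0n n0 implybT.
by rewrite ler_wpM2l ?powR_ge0 // ge0_ler_powR // ?nnegrE // ler_nat.
Qed.

Hypothesis nz : forall s : R[i], 0 < Re s -> dirichlet_poly m p s != 0.

(** Descent from the far line in steps of eta: boundedness at tau + eta gives growth at rate at most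
    theta at tau, too slow for the recursion unless the energies at tau are bounded by 1 / d. *)
Lemma dinv_energy_bounded sigma : 0 < sigma ->
  exists C, forall k, E sigma (m.+1 ^ k) <= C.
Proof.
move=> s0; have [delta d0 Hd] := dirichlet_lower_bound m0 p1 nz s0.
pose d := delta ^+ 2; have d2 : 0 < d by rewrite exprn_gt0.
pose K := 2 ^+ m * (\sum_(1 <= j < m.+1) normc (p j) ^+ 2) + d + 1.
have S0 : 0 <= 2 ^+ m * (\sum_(1 <= j < m.+1) normc (p j) ^+ 2).
  by rewrite mulr_ge0 ?exprn_ge0 // sumr_ge0 // => j _; rewrite sqr_ge0.
have dK : d < K by rewrite /K; lra.
have K0 : 0 < K by rewrite (lt_trans d2).
pose l := ln (m.+1%:R : R).
have l0 : 0 < l by rewrite ln_gt0 // ltr1n.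
(* This makes theta = exp(d / (2 K)), and exp(-u) >= 1 - u then yields theta (K - d) < K. The same
   eta works for every step of the descent. *)
pose eta := d / (4 * K * l).
have eta0 : 0 < eta by rewrite divr_gt0 // !mulr_gt0.
pose theta := m.+1%:R `^ (2 * eta) : R.
have thetaK : theta * (K - d) < K.
  have -> : theta = (expR (- (d / (2 * K))))^-1.
    rewrite /theta /powR pnatr_eq0 /= -expRN opprK; congr expR.
    by rewrite /eta -/l; field; rewrite !gt_eqF.
  rewrite mulrC ltr_pdivrMr ?expR_gt0 //.
  apply: lt_le_trans (_ : K * (1 - d / (2 * K)) <= _).
    have -> : K * (1 - d / (2 * K)) = K - d / 2 by field; rewrite gt_eqF.
    lra.
  by rewrite ler_wpM2l ?(ltW K0) // expR_ge1Dx.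
have [s1 [C1 [s10 HC1]]] := dinv_energy_far.
have step i tau : sigma <= tau -> s1 - i%:R * eta <= tau ->
    exists C, forall k, E tau (m.+1 ^ k) <= C.
  elim: i tau => [|i IH] tau st s1t.
    by exists C1 => k; rewrite (le_trans _ (HC1 (m.+1 ^ k)%N)) // dinv_energy_le //;
       move: s1t; rewrite mul0r subr0.
  have [||C HC] := IH (tau + eta).
  - lra.
  - move: s1t; rewrite -natr1 mulrDl mul1r; lra.
  exists d^-1; apply: (@bounded_of_slow_growth _ _ d K C theta) => //.
  - exact: powR_ge0.
  - move=> k; rewrite /d; apply: le_trans (dinv_energy_recursion m0 p1 k _ d0 _) _.
    + by rewrite (le_trans (ltW s0)).
    + by move=> s st'; rewrite Hd // -st'.
    rewrite lerD2l /K ler_wpM2r //; last by lra.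
    rewrite subr_ge0 /dinv_energy (@big_cat_nat _ _ _ (m.+1 ^ k).+1 1 (m.+1 ^ k.+1).+1) //=.
      by rewrite lerDl sumr_ge0 // => n _; rewrite sqr_ge0.
    by rewrite ltnS leq_exp2l.
  - move=> k; apply: le_trans (dinv_energy_shift tau k (ltW eta0)) _.
    by rewrite ler_wpM2r // exprn_ge0 // powR_ge0.
pose i := Num.bound (s1 / eta).
apply: (step i) => //.
have : s1 / eta < i%:R by rewrite archi_boundP // divr_ge0 // ltW.
by rewrite ltr_pdivrMr //; lra.
Qed.

(** A single term is at most the whole square sum on Re s = eps, and n <= (m + 1)^n puts it in
    range. *)
Lemma dinv_subpolynomial eps : 0 < eps ->
  exists2 C : R, 0 <= C & forall n, (0 < n)%N -> normc (dinv m p n) <= C * n%:R `^ eps.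
Proof.
move=> e0; have [C HC] := dinv_energy_bounded e0.
exists (Num.sqrt C); first exact: sqrtr_ge0.
move=> n n0; have n0R : 0 < n%:R :> R by rewrite ltr0n.
rewrite -ler_pdivrMr ?powR_gt0 // -powRN -[leLHS]ger0_norm; last first.
  by rewrite mulr_ge0 ?normc_ge0 ?powR_ge0.
rewrite -sqrtr_sqr ler_wsqrtr // (le_trans _ (HC n)) //.
rewrite /E /dinv_energy (bigD1_seq n) ?iota_uniq //=.
  by rewrite lerDl sumr_ge0 // => k _; rewrite sqr_ge0.
by rewrite mem_index_iota n0 ltnS ltnW // ltn_expl.
Qed.

End Subpolynomial.

(** * Convergence of the inverse in the variable lambda *)

Section Slices.
Variables (R : realType) (m : nat) (p : nat -> R[i]).
Hypothesis m0 : (0 < m)%N.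
Hypothesis p1 : p 1%N != 0.
Hypothesis nz : forall s : R[i], 0 < Re s -> dirichlet_poly m p s != 0.

(** The inverse lives on smooth l, where l^eps <= (m^eps)^Omega(l). The series is thus dominated by
    the smooth sum at x = m^eps r. *)
Lemma dinv_summable (r : R) : 0 <= r -> r < 1 ->
  exists2 C : R, 0 <= C &
    forall N, \sum_(1 <= l < N.+1) normc (dinv m p l) * r ^+ Omega m l <= C.
Proof.
move=> r0 r1; have mR : 0 < m%:R :> R by rewrite ltr0n.
pose l := ln (m%:R : R); have l0 : 0 <= l by rewrite ln_ge0 // ler1n.
(* Small enough that eps l < 1 - r, whence m^-eps = exp(- eps l) >= 1 - eps l > r and x < 1. *)
pose eps := (1 - r) / (2 * (l + 1)).
have eps0 : 0 < eps by rewrite divr_gt0 ?subr_gt0 // mulr_gt0 //; lra.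
pose x := m%:R `^ eps * r.
have x0 : 0 <= x by rewrite mulr_ge0 ?powR_ge0.
have x1 : x < 1.
  have el : eps * l < 1 - r.
    rewrite /eps mulrAC ltr_pdivrMr; last by lra.
    have : 0 <= (1 - r) * l by rewrite mulr_ge0 // subr_ge0 ltW.
    nra.
  rewrite /x; have -> : m%:R `^ eps = (expR (- (eps * l)))^-1 :> R.
    by rewrite -expRN opprK /powR pnatr_eq0 eqn0Ngt m0.
  rewrite mulrC ltr_pdivrMr ?expR_gt0 // mul1r.
  by apply: lt_le_trans (expR_ge1Dx _); lra.
have [C C0 HC] := dinv_subpolynomial m0 p1 nz eps0.
exists (C * ((1 - x)^-1) ^+ m.+1).
  by rewrite mulr_ge0 // exprn_ge0 // invr_ge0 subr_ge0 ltW.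
move=> N; apply: le_trans (ler_wpM2l C0 (smooth_sum_le m N x0 x1)).
rewrite mulr_sumr big_nat [leRHS]big_mkcond [leRHS]big_nat.
apply: ler_sum => n /andP[n0 nN].
have [cn|/negPn/eqP ->] := boolP (dinv m p n != 0); last first.
  by rewrite normc0 mul0r; case: ifP => // _; rewrite mulr_ge0 ?exprn_ge0.
have sn := dinv_smooth n0 cn; rewrite sn.
have x2 : x ^+ Omega m n = (m%:R `^ eps) ^+ Omega m n * r ^+ Omega m n.
  by rewrite /x exprMn.
rewrite x2 mulrA ler_wpM2r ?exprn_ge0 // (le_trans (HC n n0)) //.
rewrite ler_wpM2l //.
have -> : (m%:R `^ eps) ^+ Omega m n = (m ^ Omega m n)%:R `^ eps :> R.
  by rewrite -powR_mulrn ?powR_ge0 // natrX -powR_mulrn // powRAC.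
by rewrite ge0_ler_powR ?(ltW eps0) ?nnegrE // ler_nat smooth_leq_exp.
Qed.

(** The partial sum up to N of 1/Q_lambda, since lambda^Omega(n) is completely multiplicative. *)
Definition twist (N : nat) (lam : R[i]) (n : nat) : R[i] :=
  if (n <= N)%N then lam ^+ Omega m n * dinv m p n else 0.

Lemma twist0 N lam n : (N < n)%N -> twist N lam n = 0.
Proof. by rewrite /twist ltnNge => /negbTE ->. Qed.

Lemma dconv_twist_head N lam n : (0 < n)%N -> (n <= N)%N ->
  dconv m (fun j => lam ^+ Omega m j * p j) (twist N lam) n = (n == 1%N)%:R.
Proof.
move=> n0 nN.
rewrite (eq_dconv (q := fun j => lam ^+ Omega m j * p j)
  (z := fun l => lam ^+ Omega m l * dinv m p l)) //; last first.
  by move=> l /andP[_ ln]; rewrite /twist (leq_trans ln).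
rewrite dconv_twist // => [|j k j0 k0]; last by rewrite OmegaM // exprD.
rewrite dconv_dinv //; case: (eqVneq n 1%N) => [->|_]; last by rewrite mulr0.
by rewrite Omega1 mul1r.
Qed.

(** Write r = r' rho with r < r' < 1: the series still converges at r', while rho^Omega(l) is small
    for the l > N / m that enter the tail. *)
Lemma dconv_twist_tail (r eta : R) : 0 < r -> r < 1 -> 0 < eta ->
  exists N0, forall N lam, (N0 <= N)%N -> normc lam <= r ->
    \sum_(N.+1 <= n < (m * N).+1)
      normc (dconv m (fun j => lam ^+ Omega m j * p j) (twist N lam) n) <= eta.
Proof.
move=> r0 r1 eta0; pose r' := (1 + r) / 2.
have r'0 : 0 < r' by rewrite /r'; lra.
have r'1 : r' < 1 by rewrite /r'; lra.
pose rho := r / r'.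
have rho0 : 0 < rho by rewrite divr_gt0.
have rho1 : rho < 1 by rewrite ltr_pdivrMr // mul1r /r'; lra.
have [C C0 HC] := dinv_summable (ltW r'0) r'1.
pose A := \sum_(1 <= j < m.+1) normc (p j).
have A0 : 0 <= A by rewrite sumr_ge0 // => j _; exact: normc_ge0.
have [K HK] : exists K : nat, A * (C * rho ^+ K) <= eta.
  apply: contrapT => /forallNP H.
  suff : eta <= 0 by rewrite leNgt eta0.
  apply: (@ge0_geometric_le0 _ _ (A * C) rho) => [||j]; rewrite ?(ltW rho0) //.
  by rewrite -mulrA ltW // ltNge; apply/negP/H.
exists (m ^ K.+1)%N => N lam NK lamr.
apply: le_trans HK.
have lamr1 : normc lam <= 1 by rewrite (le_trans lamr) ?ltW.
pose Y l := if (l <= N)%N then normc (dinv m p l) * r ^+ Omega m l else 0.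
have Y0 l : 0 <= Y l.
  by rewrite /Y; case: ifP => // _; rewrite mulr_ge0 ?normc_ge0 // exprn_ge0 ?(ltW r0).
apply: (@le_trans _ _ (\sum_(N.+1 <= n < (m * N).+1) dconv m (fun j => normc (p j)) Y n)).
  apply: ler_sum => n _; apply: (le_trans (normc_sum _ _ _)).
  apply: ler_sum => j _; rewrite !normcM ler_pM ?mulr_ge0 ?normc_ge0 //.
    by rewrite normcX ler_piMl ?normc_ge0 // exprn_ile1 ?normc_ge0.
  rewrite /twist /Y; case: ifP => _; last by rewrite normc0.
  rewrite normcM normcX mulrC ler_wpM2l ?normc_ge0 //.
  by rewrite lerXn2r ?nnegrE ?normc_ge0 ?(ltW r0).
apply: le_trans (sum_dconv_tail_le _ _ _ _) _ => //.
- by move=> j; exact: normc_ge0.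
- by move=> l; rewrite /Y ltnNge => /negbTE ->.
rewrite ler_wpM2l //.
apply: (@le_trans _ _ (\sum_(1 <= l < N.+1)
    normc (dinv m p l) * r' ^+ Omega m l * rho ^+ K)); last first.
  by rewrite -mulr_suml ler_wpM2r // exprn_ge0 // ltW.
rewrite big_mkcond !big_nat; apply: ler_sum => l /andP[l0 lN].
case: ifP => Nl; last by rewrite !mulr_ge0 ?normc_ge0 // exprn_ge0 // ltW.
rewrite /Y -ltnS lN.
have [cl|/negPn/eqP ->] := boolP (dinv m p l != 0); last first.
  by rewrite normc0 !mul0r.
have lO := smooth_leq_exp l0 (dinv_smooth l0 cl).
(* m^(K+1) <= N < m l <= m^(Omega(l)+1); for m = 1 this chain is contradictory. *)
have KO : (K <= Omega m l)%N.
  have : (m ^ K.+1 < m ^ (Omega m l).+1)%N.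
    by rewrite (leq_ltn_trans NK) // (leq_trans Nl) // expnS leq_mul2l lO orbT.
  case: (ltnP 1 m) => [m1|m1]; first by rewrite ltn_exp2l // ltnS => /ltnW.
  have -> : m = 1%N by apply/eqP; rewrite eqn_leq m1.
  by rewrite !exp1n ltnn.
rewrite -mulrA ler_wpM2l ?normc_ge0 //.
have -> : r = r' * rho by rewrite /rho mulrC divfK // gt_eqF.
rewrite exprMn ler_wpM2l ?exprn_ge0 ?(ltW r'0) //.
by rewrite ler_wiXn2l ?(ltW rho0) ?(ltW rho1).
Qed.

End Slices.

(** * Approximate inverses that are bounded on the imaginary axis *)

Section ApproximateInverse.
Variables (R : realType) (m : nat) (p : nat -> R[i]).
Hypothesis m0 : (0 < m)%N.
Hypothesis p1 : p 1%N != 0.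
Hypothesis nz : forall s : R[i], 0 < Re s -> dirichlet_poly m p s != 0.

Let slice (lam : R[i]) (j : nat) : R[i] := lam ^+ Omega m j * p j.

(** The coefficients of the product agree with those of 1 up to N, and on the imaginary axis the
    rest is at most its absolute coefficient sum, which is the small tail. *)
Lemma slice_twist_approx (r eta : R) : 0 < r -> r < 1 -> 0 < eta ->
  exists N0, forall N lam t, (N0 <= N)%N -> normc lam <= r ->
    normc (dirichlet_poly m (slice lam) (0 +i* t)
      * dirichlet_poly N (twist m p N lam) (0 +i* t) - 1) <= eta.
Proof.
move=> r0 r1 eta0; have [N0 H] := dconv_twist_tail m0 p1 nz r0 r1 eta0.
exists N0.+1 => N lam t NN lamr; have N1 : (0 < N)%N by rewrite (leq_trans _ NN).
rewrite dirichlet_polyM; last exact: twist0.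
apply: le_trans (H N lam (ltnW NN) lamr).
rewrite /dirichlet_poly (@big_cat_nat _ _ _ N.+1) //=; last by rewrite ltnS leq_pmull.
have -> : \sum_(1 <= n < N.+1) dconv m (slice lam) (twist m p N lam) n *
    natpowC n (- (0 +i* t)) = 1.
  rewrite big_ltn // big_nat big1 => [|n /andP[n1 nN]].
    by rewrite dconv_twist_head // natpowC1 mulr1 addr0.
  by rewrite dconv_twist_head ?gtn_eqF ?mul0r // ltnW.
rewrite addrAC subrr add0r; apply: (le_trans (normc_sum _ _ _)).
rewrite !big_nat; apply: ler_sum => n /andP[Nn _].
by rewrite normcM normc_natpowC ?(leq_ltn_trans _ Nn) // ReN /= oppr0 powRr0 mulr1.
Qed.

(** At a zero the product with the approximate inverse would be 0, yet it is within 1/2 of 1. *)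
Lemma slice_neq0 (lam : R[i]) t : normc lam < 1 ->
  dirichlet_poly m (slice lam) (0 +i* t) != 0.
Proof.
move=> lam1; pose r := (1 + normc lam) / 2.
have r0 : 0 < r by rewrite /r; have := normc_ge0 lam; lra.
have r1 : r < 1 by rewrite /r; lra.
have h0 : 0 < 1 / 2 :> R by lra.
have [N0 H] := slice_twist_approx r0 r1 h0.
apply/eqP => s0; have := H N0 lam t (leqnn _); rewrite s0 mul0r sub0r normcN normc1.
have -> : normc lam <= r by rewrite /r; lra.
by move=> /(_ isT); lra.
Qed.

Definition slice_degree : nat := \sum_(1 <= j < m.+1) Omega m j.

(* Every root z of the polynomial in lambda has modulus at least 1, hence
   |1 - z| <= 2 |r - z|; the degree bound makes the constant uniform in r and t. *)
Lemma slice_ratio (r : R) t : 0 <= r -> r < 1 ->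
  normc (dirichlet_poly m p (0 +i* t)) <=
  2 ^+ slice_degree * normc (dirichlet_poly m (slice r%:C) (0 +i* t)).
Proof.
move=> r0 r1.
pose T : {poly R[i]} :=
  \sum_(1 <= j < m.+1) (p j * natpowC j (- (0 +i* t))) *: 'X^(Omega m j).
have TE lam : T.[lam] = dirichlet_poly m (slice lam) (0 +i* t).
  rewrite /T horner_sum; apply: eq_bigr => j _.
  by rewrite hornerZ hornerXn mulrC mulrA.
have sT : (size T <= slice_degree.+1)%N.
  rewrite /T big_nat; apply: (leq_trans (size_sum _ _ _)).
  apply/bigmax_leqP_seq => j; rewrite mem_index_iota => jm _.
  rewrite (leq_trans (size_scale_leq _ _)) // size_polyXn ltnS /slice_degree.
  by rewrite (bigD1_seq j) ?iota_uniq ?mem_index_iota //= leq_addr.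
have -> : dirichlet_poly m p (0 +i* t) = T.[1].
  by rewrite TE; apply: eq_bigr => j _; rewrite /slice expr1n mul1r.
rewrite -TE; apply: poly_ratio => //; first by rewrite ler1n.
move=> z rz; have z1 : 1 <= normc z.
  by rewrite leNgt; apply/negP => /(slice_neq0 t); rewrite -TE (rootP rz) eqxx.
have -> : 1 - z = (1 - r)%:C + (r%:C - z).
  by rewrite rmorphB rmorph1 /= addrA subrK.
apply: le_trans (le_normcD _ _) _; rewrite normc_real ger0_norm; last by lra.
have := normcB_ge z r%:C; rewrite normc_distC normc_real (ger0_norm r0); lra.
Qed.

(** Let D be a long partial sum of 1/Q_r with r = 1 - h. Then Q D = (Q / Q_r) (Q_r D) is bounded by
    2^degree times 2, whatever h is. As 1 - r^Omega(l) <= Omega(l) h, the coefficients up to X are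
    off by at most h A G. *)
Lemma approximate_inverse : exists2 B : R, 0 <= B & forall X nu, 0 < nu ->
  exists N (y : nat -> R[i]), [/\ (X <= N)%N, forall k, (N < k)%N -> y k = 0,
    forall t, normc (dirichlet_poly (m * N) (dconv m p y) (0 +i* t)) <= B &
    forall n, (0 < n <= X)%N -> normc (dconv m p y n - (n == 1%N)%:R) <= nu].
Proof.
exists (2 ^+ slice_degree * 2); first by rewrite mulr_ge0 ?exprn_ge0.
move=> X nu nu0.
pose A := \sum_(1 <= j < m.+1) normc (p j).
have A0 : 0 <= A by rewrite sumr_ge0 // => j _; exact: normc_ge0.
pose G := \sum_(1 <= l < X.+1) normc (dinv m p l) * (Omega m l)%:R.
have G0 : 0 <= G by rewrite sumr_ge0 // => j _; rewrite mulr_ge0 ?normc_ge0.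
pose h := Num.min (1 / 2) (nu / (A * G + 1)).
have AG0 : 0 < A * G + 1 by rewrite ltr_wpDl // mulr_ge0.
have h0 : 0 < h by rewrite lt_min !divr_gt0.
have h2 : h <= 1 / 2 by rewrite ge_min lexx.
have hnu : h * (A * G) <= nu.
  have : h * (A * G + 1) <= nu by rewrite -ler_pdivlMr // ge_min lexx orbT.
  by rewrite mulrDr mulr1; lra.
pose r := 1 - h.
have r0 : 0 < r by rewrite /r; lra.
have r1 : r < 1 by rewrite /r; lra.
have rh : 1 - r = h by rewrite /r; lra.
clearbody r; have [N0 HN0] := slice_twist_approx r0 r1 (ltr01 : 0 < 1 :> R).
pose N := maxn N0 X; exists N, (twist m p N r%:C); split.
- exact: leq_maxr.
- by move=> k; exact: twist0.
- move=> t; rewrite -dirichlet_polyM; last by move=> k; exact: twist0.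
  rewrite normcM; apply: le_trans (ler_wpM2r (normc_ge0 _) (slice_ratio t (ltW r0) r1)) _.
  rewrite -mulrA ler_wpM2l ?exprn_ge0 // -normcM.
  have := HN0 N r%:C t (leq_maxl _ _); rewrite normc_real gtr0_norm // => /(_ (lexx _)).
  set z := _ * _ => Hz.
  have -> : z = (z - 1) + 1 by rewrite subrK.
  by apply: le_trans (le_normcD _ _) _; rewrite normc1; lra.
move=> n /andP[n0 nX].
rewrite -(dconv_dinv m0 p1 n0) /dconv -sumrB.
apply: le_trans (normc_sum _ _ _) _; apply: le_trans hnu.
rewrite mulrCA /A mulr_suml big_nat_cond [leRHS]big_nat.
rewrite big_mkcond /= [leRHS]big_mkcond; apply: ler_sum => j _.
have [/andP[/andP[-> ->] jn]|_] := ifP; last first.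
  by case: ifP => // _; rewrite !mulr_ge0 ?normc_ge0 // ltW.
rewrite -mulrBr normcM ler_wpM2l ?normc_ge0 //.
have l0 : (0 < n %/ j)%N by rewrite divn_gt0 ?(dvdn_leq n0) // (dvdn_gt0 n0).
have lX : (n %/ j <= X)%N by rewrite (leq_trans (leq_div _ _)).
rewrite /twist (leq_trans lX) ?leq_maxr //.
move: (n %/ j)%N l0 lX => l l0 lX.
apply: (@le_trans _ _ (h * (normc (dinv m p l) * (Omega m l)%:R))).
  have -> : r%:C ^+ Omega m l * dinv m p l - dinv m p l =
      (r ^+ Omega m l - 1)%:C * dinv m p l.
    by rewrite rmorphB rmorph1 rmorphXn mulrBl mul1r.
  rewrite normcM normc_real distrC ger0_norm; last first.
    by rewrite subr_ge0 exprn_ile1 ?ltW.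
  rewrite mulrC mulrCA ler_wpM2l ?normc_ge0 //.
  rewrite (le_trans (bernoulli_sub _ (ltW r0) (ltW r1))) //.
  by rewrite rh mulrC.
rewrite ler_wpM2l ?(ltW h0) // /G (bigD1_seq l) ?iota_uniq ?mem_index_iota ?l0 //=.
by rewrite lerDl sumr_ge0 // => k _; rewrite mulr_ge0 ?normc_ge0.
Qed.

End ApproximateInverse.

(** * The quadratic form of step functions *)

Section Energy.
Variable R : realType.
Implicit Types (f g : nat -> R[i]).

(* The squared L2 norm of the step function sum_k f_k 1_(0, 1/k]. *)
Definition energy (N : nat) (f : nat -> R[i]) : R :=
  \sum_(1 <= k < N.+1) \sum_(1 <= l < N.+1) Re (f k * conjc (f l)) / (maxn k l)%:R.

(* The length of {x | floor (1 / x) = i} for i < N; the last weight collects all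
   x <= 1 / N. *)
Definition weight (N i : nat) : R :=
  if (i < N)%N then i%:R^-1 - i.+1%:R^-1 else N%:R^-1.

Lemma weight_ge0 N i : (0 < i)%N -> 0 <= weight N i.
Proof.
move=> i0; rewrite /weight; case: ifP => // _; rewrite ?invr_ge0 // subr_ge0.
by rewrite lef_pV2 ?posrE ?ltr0n // ler_nat.
Qed.

Lemma sum_telescope_cut (V : zmodType) (u : nat -> V) N k : (0 < k <= N)%N ->
  \sum_(1 <= i < N.+1 | (k <= i)%N) (if (i < N)%N then u i - u i.+1 else u N) = u k.
Proof.
move=> /andP[k0 kN]; pose v i := if (i < N)%N then u i - u i.+1 else u N.
rewrite -[LHS]/(\sum_(1 <= i < N.+1 | (k <= i)%N) v i).
rewrite (@big_cat_nat _ _ _ k) //=; last by rewrite leqW.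
rewrite big_nat_cond big1 ?add0r => [|i /andP[/andP[_ ik]]]; last by rewrite leqNgt ik.
have -> : \sum_(k <= i < N.+1 | (k <= i)%N) v i = \sum_(k <= i < N.+1) v i.
  rewrite big_nat_cond [RHS]big_nat_cond; apply: eq_bigl => i.
  by case: (k <= i)%N; rewrite ?andbT.
rewrite big_nat_recr //= {2}/v ltnn.
rewrite (eq_big_nat _ _ (F2 := fun i => - u i.+1 - - u i)) => [|i /andP[_ iN]].
  by rewrite telescope_sumr // opprK addrC addrA subrr add0r.
by rewrite /v iN opprK addrC.
Qed.

Lemma weight_sum N k : (0 < k <= N)%N ->
  \sum_(1 <= i < N.+1 | (k <= i)%N) weight N i = k%:R^-1.
Proof. exact: (sum_telescope_cut (fun i => i%:R^-1)). Qed.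

(** 1 / max(kap k, kap l) is the total weight of the i at which both partial sums are switched on.
    [kap = id] gives [energy], and [kap = muln d] its dilate by d. *)
Lemma weighted_energy (X N : nat) (kap : nat -> nat) (f : nat -> R[i]) :
  (forall j, (0 < j <= X)%N -> (0 < kap j <= N)%N) ->
  \sum_(1 <= i < N.+1) weight N i
    * normc (\sum_(1 <= j < X.+1 | (kap j <= i)%N) f j) ^+ 2 =
  \sum_(1 <= k < X.+1) \sum_(1 <= l < X.+1)
    Re (f k * conjc (f l)) / (maxn (kap k) (kap l))%:R.
Proof.
move=> kapN.
have E i : weight N i * normc (\sum_(1 <= j < X.+1 | (kap j <= i)%N) f j) ^+ 2 =
    \sum_(1 <= k < X.+1) \sum_(1 <= l < X.+1)
      (if (maxn (kap k) (kap l) <= i)%N then Re (f k * conjc (f l)) * weight N i else 0).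
  rewrite sqr_normc_sum mulr_sumr big_mkcond; apply: eq_bigr => k _.
  rewrite mulr_sumr big_mkcond; case: ifP => kk; last first.
    by rewrite big1 // => l _; rewrite geq_max kk.
  apply: eq_bigr => l _; rewrite geq_max kk /=.
  by case: ifP => // _; rewrite mulrC.
under eq_bigr do rewrite E.
rewrite exchange_big; apply: eq_big_nat => k kX.
rewrite exchange_big; apply: eq_big_nat => l lX.
rewrite -big_mkcond -mulr_sumr weight_sum //.
have := kapN k kX; have := kapN l lX; lia.
Qed.

Lemma energyE N f : energy N f = \sum_(1 <= i < N.+1) weight N i
    * normc (\sum_(1 <= j < N.+1 | (j <= i)%N) f j) ^+ 2.
Proof. by rewrite (weighted_energy (kap := id)). Qed.

Lemma energy_ge0 N f : 0 <= energy N f.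
Proof.
rewrite energyE big_nat; apply: sumr_ge0 => i /andP[i0 _].
by rewrite mulr_ge0 ?weight_ge0 ?sqr_ge0.
Qed.

End Energy.

Lemma OmegaX m n k : (0 < n)%N -> Omega m (n ^ k) = (k * Omega m n)%N.
Proof.
move=> n0; elim: k => [|k IH]; first by rewrite expn0 Omega1.
by rewrite expnS OmegaM ?expn_gt0 ?n0 // IH mulSn.
Qed.

(** * Transference from the imaginary axis to the energy norm *)

Section Folner.
Variable R : realType.

Definition ndivisors (n : nat) : R := \sum_(1 <= k < n.+1 | (k %| n)%N) 1.

Lemma ndivisorsE n X : (0 < n <= X)%N ->
  \sum_(1 <= k < X.+1 | (k %| n)%N) 1 = ndivisors n.
Proof.
move=> /andP[n0 nX]; rewrite /ndivisors (@big_cat_nat _ _ _ n.+1) //=.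
rewrite [X in _ + X]big_nat_cond [X in _ + X]big1 ?addr0 //.
by move=> k /andP[/andP[nk _] /(dvdn_leq n0)]; rewrite leqNgt nk.
Qed.

Lemma ndivisors_gt0 n : (0 < n)%N -> 0 < ndivisors n.
Proof.
move=> n0; rewrite /ndivisors big_ltn_cond ?ltnS // dvd1n.
by rewrite ltr_wpDr // sumr_ge0.
Qed.

(** Otherwise J^N would have at least 2^N divisors, whereas the smooth sum bound only allows
    O((3/2)^N). *)
Lemma ndivisors_doubling J : (0 < J)%N ->
  exists N, ndivisors (J ^ N.+1) <= 2 * ndivisors (J ^ N).
Proof.
move=> J0; apply: contrapT => /forallNP H.
have lower N : 2 ^+ N <= ndivisors (J ^ N).
  elim: N => [|N IH]; first by rewrite expn0 /ndivisors big_mkcond big_nat1.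
  rewrite exprS (le_trans (ler_wpM2l _ IH)) //.
  by rewrite ltW // ltNge; apply/negP/H.
pose w := (Omega J J).+1.
(* A divisor of J^N has Omega at most w N, and this x satisfies x^w >= 2/3 by Bernoulli, so each
   divisor adds at least (2/3)^N to the smooth sum. *)
pose x : R := 1 - (3 * w%:R)^-1.
have w0 : 0 < w%:R :> R by rewrite ltr0n.
have x1 : x < 1 by rewrite /x gtrBl invr_gt0 mulr_gt0.
have x0 : 0 < x.
  rewrite /x subr_gt0 invf_lt1 ?mulr_gt0 //.
  have w1 : 1 <= w%:R :> R by rewrite ler1n.
  lra.
have xw : 2 / 3 <= x ^+ w.
  have := bernoulli_sub w (ltW x0) (ltW x1).
  have -> : w%:R * (1 - x) = 3^-1 by rewrite /x; field; rewrite gt_eqF.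
  lra.
pose C := ((1 - x)^-1) ^+ J.+1.
have upper N : (2 / 3) ^+ N * ndivisors (J ^ N) <= C.
  apply: le_trans (smooth_sum_le J (J ^ N) (ltW x0) x1).
  rewrite /ndivisors mulr_sumr big_mkcond [leRHS]big_mkcond big_nat [leRHS]big_nat.
  apply: ler_sum => n /andP[n0 nN].
  case: ifP => [nJ|_]; last by case: ifP => // _; rewrite exprn_ge0 ?ltW.
  have JN0 : (0 < J ^ N)%N by rewrite expn_gt0 J0.
  have -> : smooth J n.
    apply/allP => q; rewrite mem_primes => /and3P[qp _ qn].
    have := dvdn_trans qn nJ; rewrite Euclid_dvdX // => /andP[qJ _].
    exact: dvdn_leq.
  rewrite mulr1; apply: (@le_trans _ _ ((x ^+ w) ^+ N)).
    by rewrite lerXn2r ?nnegrE ?divr_ge0 ?exprn_ge0 ?(ltW x0).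
  rewrite -exprM ler_wiXn2l ?(ltW x0) ?(ltW x1) //.
  have : (Omega J n <= Omega J (J ^ N))%N.
    by rewrite -(divnK nJ) mulnC OmegaM ?leq_addr // divn_gt0 // dvdn_leq.
  by rewrite OmegaX // => /leq_trans; apply; rewrite mulnC leq_mul2r leqnSn orbT.
suff : (1 : R) <= 0 by rewrite lt_geF.
apply: (@ge0_geometric_le0 _ _ C (3 / 4)) => [||N]; [lra|lra|].
have := upper N; have := lower N.
have a0 : 0 < (2 / 3 : R) ^+ N by rewrite exprn_gt0 //; lra.
have b0 : 0 < (3 / 4 : R) ^+ N by rewrite exprn_gt0 //; lra.
move=> l u; have : (2 / 3) ^+ N * 2 ^+ N <= C.
  by apply: le_trans u; rewrite ler_wpM2l // ltW.
move=> /(ler_wpM2r (ltW b0)); rewrite -!exprMn.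
have -> : 2 / 3 * 2 * (3 / 4) = 1 :> R by field.
by rewrite expr1n.
Qed.

(* For each i, y i lists the values at 1/i of the dilates by L/n (n | L) of the
   step function 1_(0,1], scaled to norm 1. Convolving with F is exact at the n
   divisible by J, which are at least half of the divisors of L for a suitable
   power L of J. *)
Lemma energy_le_sup X (F : nat -> R[i]) (B : R) : (0 < X)%N ->
  (forall t, normc (dirichlet_poly X F (0 +i* t)) <= B) ->
  energy X (fun k => (Num.sqrt k%:R)%:C * F k) <= 2 * B ^+ 2.
Proof.
move=> X0 HB; have B0 : 0 <= B by apply: le_trans (HB 0); exact: normc_ge0.
pose J := X`!; have J0 : (0 < J)%N by exact: fact_gt0.
have [N JN] := ndivisors_doubling J0.
pose L := (J ^ N.+1)%N; pose L' := (J ^ N)%N.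
have L0 : (0 < L)%N by rewrite expn_gt0 J0.
have L'0 : (0 < L')%N by rewrite expn_gt0 J0.
have LE : L = (J * L')%N by rewrite /L expnS.
set G := fun k => _; set E := energy X G.
suff : ndivisors L' * E <= ndivisors L' * (2 * B ^+ 2).
  by rewrite ler_pM2l // ndivisors_gt0.
apply: (@le_trans _ _ (B ^+ 2 * ndivisors L)); last first.
  have -> : ndivisors L' * (2 * B ^+ 2) = B ^+ 2 * (2 * ndivisors L') by ring.
  by rewrite ler_wpM2l ?sqr_ge0.
(* Large enough both for the support of the convolutions and for all jumps d j with d <= L and j <=
   X. *)
pose Nt := (X * L)%N.
have LNt : (L <= Nt)%N by rewrite leq_pmull.
pose y i n : R[i] := if (n %| L)%N && (L %/ n <= i)%N
  then (Num.sqrt (L %/ n)%:R)%:C else 0.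
have y0 i n : (L < n)%N -> y i n = 0.
  by move=> Ln; rewrite /y; case: ifP => // /andP[/(dvdn_leq L0)]; rewrite leqNgt Ln.
have key i : \sum_(1 <= n < Nt.+1) normc (dconv X F (y i) n) ^+ 2 <=
    B ^+ 2 * \sum_(1 <= n < Nt.+1) normc (y i n) ^+ 2.
  have -> : B ^+ 2 * \sum_(1 <= n < Nt.+1) normc (y i n) ^+ 2 =
      \sum_(1 <= n < Nt.+1) normc (B%:C * y i n) ^+ 2.
    rewrite mulr_sumr; apply: eq_bigr => n _.
    by rewrite normcM exprMn normc_real ger0_norm.
  apply: parseval_le => t; rewrite -dirichlet_polyM; last exact: y0.
  have -> : dirichlet_poly Nt (fun n => B%:C * y i n) (0 +i* t) =
      B%:C * dirichlet_poly L (y i) (0 +i* t).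
    rewrite -(dirichlet_poly_trunc _ LNt); last exact: y0.
    rewrite /dirichlet_poly mulr_sumr.
    by apply: eq_bigr => n _ /=; rewrite -mulrA.
  by rewrite !normcM ler_wpM2r ?normc_ge0 // normc_real ger0_norm.
(* Each divisor n of L contributes L / n times the weight n / L of the range i >= L / n, that is
   1. *)
have rhs : \sum_(1 <= i < Nt.+1) weight R Nt i *
    \sum_(1 <= n < Nt.+1) normc (y i n) ^+ 2 = ndivisors L.
  under eq_bigr do rewrite mulr_sumr.
  rewrite exchange_big -(ndivisorsE (X := Nt)) ?L0 // [RHS]big_mkcond.
  apply: eq_big_nat => n /andP[n0 nN]; case: ifP => nL; last first.
    by rewrite big1 // => i _; rewrite /y nL normc0 expr0n mulr0.
  have Ln0 : (0 < L %/ n)%N by rewrite divn_gt0 // dvdn_leq.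
  have LnR : 0 < (L %/ n)%:R :> R by rewrite ltr0n.
  rewrite (eq_bigr (fun i => if (L %/ n <= i)%N then
      (L %/ n)%:R * weight R Nt i else 0)); last first.
    move=> i _; rewrite /y nL /=; case: ifP => _; last by rewrite normc0 expr0n mulr0.
    by rewrite normc_real ger0_norm ?sqrtr_ge0 // sqr_sqrtr ?ltW // mulrC.
  rewrite -big_mkcond -mulr_sumr weight_sum ?divff ?gt_eqF //.
  by rewrite Ln0 (leq_trans (leq_div _ _)).
rewrite -rhs mulr_sumr.
have lhs n : (0 < n)%N -> (J %| n)%N -> (n %| L)%N ->
    \sum_(1 <= i < Nt.+1) weight R Nt i * normc (dconv X F (y i) n) ^+ 2 = E.
  move=> n0 Jn nL; pose d := (L %/ n)%N.
  have d0 : (0 < d)%N by rewrite divn_gt0 // dvdn_leq.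
  have dR : 0 < d%:R :> R by rewrite ltr0n.
  have dconvE i : dconv X F (y i) n =
      (Num.sqrt d%:R)%:C * \sum_(1 <= j < X.+1 | (d * j <= i)%N) G j.
    rewrite /dconv mulr_sumr big_mkcond [RHS]big_mkcond.
    apply: eq_big_nat => j /andP[j0 jX].
    (* X! divides n, so no j <= X is lost, and sqrt(L / (n / j)) = sqrt d sqrt j produces the factor
       sqrt j of [G]. *)
    have jn : (j %| n)%N by apply: dvdn_trans Jn; rewrite dvdn_fact // j0.
    have njL : (n %/ j %| L)%N by apply: dvdn_trans nL; rewrite dvdn_div.
    have LnjE : (L %/ (n %/ j) = d * j)%N.
      have {1}-> : L = (d * j * (n %/ j))%N.
        by rewrite -mulnA [(j * _)%N]mulnC (divnK jn) /d divnK.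
      by rewrite mulnK // divn_gt0 // dvdn_leq.
    rewrite jn /y njL LnjE /=; case: ifP => _; last by rewrite mulr0.
    by rewrite natrM sqrtrM ?ltW // rmorphM /G /= mulrC mulrA.
  under eq_bigr do rewrite dconvE normcM exprMn mulrCA.
  rewrite -mulr_sumr (weighted_energy (kap := muln d)); last first.
    move=> j /andP[j0 jX]; rewrite muln_gt0 d0 j0 /= /Nt mulnC leq_mul //.
    exact: leq_div.
  rewrite normc_real ger0_norm ?sqrtr_ge0 // sqr_sqrtr ?ltW // mulr_sumr.
  apply: eq_bigr => k _; rewrite mulr_sumr; apply: eq_bigr => l _.
  by rewrite -maxnMr natrM invfM mulrCA [d%:R * _]mulrA divff ?gt_eqF // mul1r.
apply: (@le_trans _ _ (\sum_(1 <= i < Nt.+1) weight R Nt i *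
   \sum_(1 <= n < Nt.+1) normc (dconv X F (y i) n) ^+ 2)); last first.
  rewrite !big_nat; apply: ler_sum => i /andP[i0 _].
  by rewrite mulrCA ler_wpM2l ?weight_ge0.
under [leRHS]eq_bigr do rewrite mulr_sumr.
rewrite exchange_big /=.
apply: (@le_trans _ _ (\sum_(1 <= n < Nt.+1 | (J %| n)%N) (if (n %| L)%N then E else 0))).
  (* The divisors of L = J L' that are multiples of J correspond to the divisors of L'. *)
  rewrite (sum_multiples (N := L')) //; last 2 first.
  - by rewrite -LE.
  - move=> n n0 Jn Ln; case: ifP => // /(dvdn_leq L0); rewrite leqNgt.
    by rewrite LE mulnC -ltn_divRL // Ln.
  rewrite /ndivisors mulr_suml big_mkcond le_eqVlt; apply/orP; left; apply/eqP.
  by apply: eq_bigr => k _; rewrite LE dvdn_pmul2l // mul1r.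
rewrite big_mkcond !big_nat; apply: ler_sum => n /andP[n0 nN].
have pos : 0 <= \sum_(1 <= i < Nt.+1) weight R Nt i * normc (dconv X F (y i) n) ^+ 2.
  by rewrite big_nat sumr_ge0 // => i /andP[i0 _]; rewrite mulr_ge0 ?weight_ge0 ?sqr_ge0.
by case: ifP => // Jn; case: ifP => // nL; rewrite lhs.
Qed.

End Folner.

(** * From the integral to the quadratic form *)

Section Integral.
Variable R : realType.

Let D : set R := `]0%R, +oo[%classic.

Let step_sqr (N : nat) (g : nat -> R[i]) (x : R) : \bar R :=
  (normc (\sum_(1 <= l < N.+1 | l%:R * x <= 1) g l) ^+ 2)%:E.

(** Expand the square: the indicators of (0, 1/k] and (0, 1/l] multiply to that of (0, 1/max(k, l)].
    Measurability is kept for the later removal of a point from the domain. *)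
Lemma integral_step_sqr (N : nat) (g : nat -> R[i]) :
  (\int[lebesgue_measure]_(x in D)
     (normc (\sum_(1 <= l < N.+1 | l%:R * x <= 1) g l) ^+ 2)%:E
   = (energy N g)%:E)%E /\
  measurable_fun D (step_sqr N g).
Proof.
pose I (k l : nat) : set R := `]0%R, (maxn k l)%:R^-1]%classic.
pose h (k l : nat) (x : R) : \bar R :=
  ((Re (g k * conjc (g l)))%:E * (\1_(I k l) x)%:E)%E.
have mD : measurable D by exact: measurable_itv.
have mI k l : measurable (I k l) by exact: measurable_itv.
have ii k l : lebesgue_measure.-integrable D (fun x => (\1_(I k l) x)%:E).
  apply: (integrableS measurableT) => //.
  exact: (integrable_indic_itv 0 _ false false).
have ih k l : lebesgue_measure.-integrable D (h k l).
  by apply: integrableZl.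
have pw : {in D, (fun x : R =>
      (\sum_(1 <= k < N.+1) \sum_(1 <= l < N.+1) h k l x)%E) =1
     (fun x : R => (normc (\sum_(1 <= l < N.+1 | l%:R * x <= 1) g l) ^+ 2)%:E)}.
  move=> x; rewrite inE /D /= in_itv /= andbT => x0.
  have hE k l : (0 < k)%N -> (0 < l)%N -> h k l x =
      (if (k%:R * x <= 1) && (l%:R * x <= 1) then Re (g k * conjc (g l)) else 0)%:E.
    move=> k0 l0; rewrite /h -EFinM indicE; congr EFin.
    have -> : (x \in I k l) = (k%:R * x <= 1) && (l%:R * x <= 1).
      apply/idP/idP; rewrite inE /I /= in_itv /= x0 /=.
        rewrite -[_^-1]mul1r ler_pdivlMr ?ltr0n ?leq_max ?k0 // mulrC => H.
        by rewrite !(le_trans _ H) // ler_wpM2r ?(ltW x0) // ler_nat ?leq_maxl ?leq_maxr.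
      move=> /andP[kx lx]; rewrite -[_^-1]mul1r ler_pdivlMr ?ltr0n ?leq_max ?k0 // mulrC.
      by case: (leqP k l) => _.
    by case: ifP => _; rewrite ?mulr1 ?mulr0.
  rewrite sqr_normc_sum [X in X%:E]big_mkcond -sumEFin; apply: eq_big_nat => k /andP[k0 _].
  rewrite [in RHS]big_mkcond.
  under eq_big_nat => l /andP[l0 _] do rewrite hE //.
  rewrite sumEFin; congr EFin; case: ifP => _ /=; last by rewrite big1.
  by apply: eq_bigr => l _; case: ifP.
split; last first.
  apply: (eq_measurable_fun _ pw).
  apply: (measurable_int lebesgue_measure).
  by apply: integrable_sum => // k _; apply: integrable_sum.
transitivity (\int[lebesgue_measure]_(x in D) (\sum_(1 <= k < N.+1) \sum_(1 <= l < N.+1) h k l x))%E.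
  by apply: eq_integral => x xD; rewrite pw.
rewrite integral_sum //; last first.
  by move=> k; apply: integrable_sum.
rewrite /energy -sumEFin; apply: eq_big_nat => k /andP[k0 _].
rewrite integral_sum // -sumEFin; apply: eq_big_nat => l /andP[l0 _].
rewrite integralZl // integral_indic //; last exact: mI.
have -> : I k l `&` D = I k l.
  by apply: setIidl => x; rewrite /I /D /= !in_itv /= andbT => /andP[].
rewrite /= /I lebesgue_measure_itv /= lte_fin invr_gt0 ltr0n leq_max k0 /=.
by rewrite oppr0 adde0 -EFinM.
Qed.

End Integral.

Section SquareError.
Variables (R : realType) (m : nat) (a : nat -> R[i]) (r : R).

Definition kappa_coef (j : nat) : R[i] := a j / (j%:R `^ (r - 2^-1))%:C.

(* The coefficients in the step functions 1_(0, 1/l] of the function whose norm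
   is measured by sq_error. *)
Definition residual (b : nat -> R[i]) (l : nat) : R[i] :=
  (l == 1%N)%:R - dconv m kappa_coef b l.

(** kappa_r(1/(kx)) collects the j with j k x <= 1; grouping by l = j k gives the convolution. At x
    = 1 the open interval (0, 1) and the condition x <= 1 disagree. *)
Let approx_stepE (n N : nat) (b : nat -> R[i]) (x : R) :
  (m * n <= N)%N -> (0 < N)%N -> (forall k, (n < k)%N -> b k = 0) -> 0 < x ->
  x != 1 ->
  (\1_(`]0, 1[ : set R) x)%:C - \sum_(1 <= k < n.+1) b k * kappa m a r (k%:R * x)^-1
  = \sum_(1 <= l < N.+1 | l%:R * x <= 1) residual b l.
Proof.
move=> mnN N0 bn x0 x1; rewrite /residual sumrB; congr (_ - _).
  rewrite big_mkcond big_ltn // mul1r big_nat big1 ?addr0; last first.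
    by move=> l /andP[l1 _]; rewrite gtn_eqF //; case: ifP.
  rewrite eqxx indicE; have -> : (x \in (`]0, 1[%classic : set R)) = (x <= 1).
    by rewrite le_eqVlt (negbTE x1) /=; apply/idP/idP; rewrite inE /= in_itv /= x0.
  by rewrite /= addr0; case: ifP => _; rewrite ?rmorph1 ?rmorph0.
rewrite /dconv (exchange_big_dep_nat xpredT) //=.
under eq_bigr do rewrite /kappa mulr_sumr.
rewrite (exchange_big_dep_nat xpredT) //=; apply: eq_big_nat => j /andP[j0 jm].
have -> : \sum_(1 <= l < N.+1 | (l%:R * x <= 1) && (j %| l)%N)
    kappa_coef j * b (l %/ j)%N =
  \sum_(1 <= l < N.+1 | (j %| l)%N)
    (if l%:R * x <= 1 then kappa_coef j * b (l %/ j)%N else 0).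
  by rewrite big_mkcondl.
rewrite (sum_multiples (N := n)) //; last 2 first.
- by rewrite (leq_trans _ mnN) // leq_mul2r -ltnS jm orbT.
- by move=> l l0 jl nl; rewrite bn // mulr0; case: ifP.
rewrite [LHS]big_mkcond; apply: eq_big_nat => k /andP[k0 kn].
have -> : (j%:R <= (k%:R * x)^-1) = ((j * k)%:R * x <= 1).
  by rewrite -[_^-1]mul1r ler_pdivlMr ?mulr_gt0 ?ltr0n // mulrA natrM.
by rewrite mulKn // [kappa_coef j * _]mulrC.
Qed.

Lemma sq_errorE (n N : nat) (b : nat -> R[i]) :
  (m * n <= N)%N -> (0 < N)%N -> (forall k, (n < k)%N -> b k = 0) ->
  sq_error m a r n b = (energy N (residual b))%:E.
Proof.
move=> mnN N0 bn; have [<- mf] := integral_step_sqr N (residual b).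
rewrite /sq_error.
pose D : set R := `]0%R, +oo[%classic.
(* The two integrands may differ at x = 1, a null set, which is removed from both integrals. *)
have mD1 : measurable (D `\ 1 : set R).
  by apply: measurableD => //; exact: measurable_itv.
have E : {in D `\ 1, (fun x : R =>
    (normc (\sum_(1 <= l < N.+1 | l%:R * x <= 1) residual b l) ^+ 2)%:E) =1
  (fun x : R => (normc ((\1_(`]0, 1[ : set R) x)%:C
    - \sum_(1 <= k < n.+1) b k * kappa m a r (k%:R * x)^-1) ^+ 2)%:E)}.
  move=> x; rewrite inE /D /= in_itv /= andbT => -[x0 /eqP x1].
  by rewrite (approx_stepE mnN N0 bn x0 x1).
have mf1 : measurable_fun (D `\ 1) (fun x : R =>
    (normc (\sum_(1 <= l < N.+1 | l%:R * x <= 1) residual b l) ^+ 2)%:E).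
  by apply: measurable_funS mf.
rewrite -(integral_setD1 mD1) -/D; last exact: eq_measurable_fun E mf1.
rewrite -[RHS](integral_setD1 mD1 mf1).
by apply: eq_integral => x xD; rewrite E.
Qed.

End SquareError.

(** * Evaluation at a point of the half-plane *)

Section Evaluation.
Variable R : realType.

Lemma ln_succ_bounds (i : nat) : (0 < i)%N ->
  i.+1%:R^-1 <= ln i.+1%:R - ln i%:R :> R /\ ln i.+1%:R - ln i%:R <= i%:R^-1 :> R.
Proof.
move=> i0; have a0 : 0 < i%:R :> R by rewrite ltr0n.
rewrite -natr1; move: (i%:R) a0 => a a0.
have a10 : 0 < a + 1 by lra.
split.
  rewrite -lerN2 opprB -ln_div ?posrE //.
  have -> : a / (a + 1) = 1 + - (a + 1)^-1 by field; rewrite gt_eqF.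
  by apply: le_ln1Dx; rewrite ltrN2 invf_lt1 //; lra.
rewrite -ln_div ?posrE //.
have -> : (a + 1) / a = 1 + a^-1 by field; rewrite gt_eqF.
by apply: le_ln1Dx; apply: (@lt_trans _ _ 0); rewrite ?invr_gt0 ?oppr_lt0.
Qed.

(** Telescoping: (i + 1)^-alpha <= i^-alpha / (1 + alpha / (i + 1)), so each term is at most (2 +
    alpha) / alpha times the drop of i^-alpha. *)
Lemma sum_powR_le (alpha : R) N : 0 < alpha ->
  \sum_(1 <= i < N.+1) i%:R `^ (- alpha) / i%:R <= (2 + alpha) / alpha.
Proof.
move=> al0; pose u i : R := i%:R `^ (- alpha).
have step i : (0 < i)%N -> u i / i%:R <= (2 + alpha) / alpha * (u i - u i.+1).
  move=> i0; have a0 : 0 < i%:R :> R by rewrite ltr0n.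
  have a1 : 1 <= i%:R :> R by rewrite ler1n.
  have [h1 _] := ln_succ_bounds i0.
  have b0 : 0 < i.+1%:R :> R by rewrite ltr0n.
  have uE : u i.+1 <= u i / (1 + alpha / i.+1%:R).
    rewrite /u /powR !pnatr_eq0 /= gtn_eqF //.
    rewrite ler_pdivlMr ?addr_gt0 ?divr_gt0 //.
    apply: (@le_trans _ _ (expR (- alpha * ln i.+1%:R) * expR (alpha / i.+1%:R))).
      by rewrite ler_wpM2l ?expR_ge0 // expR_ge1Dx.
    rewrite -expRD ler_expR; have := ler_wpM2l (ltW al0) h1.
    by move: (ln _) (ln _) (_^-1) => x y z; rewrite mulrBr !mulNr; lra.
  have u0 : 0 < u i by rewrite powR_gt0.
  apply: (@le_trans _ _ ((2 + alpha) / alpha * (u i - u i / (1 + alpha / i.+1%:R)))).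
    have -> : u i - u i / (1 + alpha / i.+1%:R) = u i * (alpha / (i.+1%:R + alpha)).
      move: (i.+1%:R) b0 => b b0; field; rewrite !gt_eqF //; lra.
    rewrite mulrCA ler_wpM2l ?(ltW u0) //.
    rewrite mulrA divfK ?gt_eqF // -[i.+1%:R]natr1.
    rewrite ler_pdivlMr; last by lra.
    by rewrite ler_pdivrMl //; nra.
  by rewrite ler_wpM2l ?divr_ge0 ?(ltW al0) ?addr_ge0 ?(ltW al0) // lerD2l lerN2.
apply: (@le_trans _ _ (\sum_(1 <= i < N.+1) (2 + alpha) / alpha * (u i - u i.+1))).
  by rewrite !big_nat; apply: ler_sum => i /andP[i0 _]; exact: step.
rewrite -mulr_sumr -[leRHS]mulr1 ler_wpM2l //.
  by rewrite divr_ge0 ?addr_ge0 ?(ltW al0).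
under eq_bigr do rewrite -opprB.
by rewrite sumrN telescope_sumr // opprB /u powR1 gerBl powR_ge0.
Qed.

(** The quotient of the two powers is exp(- s h) with h = log((i + 1) / i) <= 1 / i; use the
    first-order Taylor bound. *)
Lemma natpowC_succ_le (s : R[i]) (i : nat) : (0 < i)%N ->
  normc (natpowC i (- s) - natpowC i.+1 (- s)) <=
  normc s * expR (normc s) * (i%:R `^ (- Re s) / i%:R).
Proof.
move=> i0; have [h1 h2] := ln_succ_bounds i0.
pose h : R := ln i.+1%:R - ln i%:R.
have h0 : 0 <= h by rewrite (le_trans _ h1) // invr_ge0.
have -> : natpowC i.+1 (- s) = natpowC i (- s) * expC (- s * h%:C).
  by rewrite /natpowC -expCD -mulrDr -rmorphD /= addrC subrK.
rewrite -{1}[natpowC i _]mulr1 -mulrBr normcM normc_natpowC // ReN.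
rewrite mulrCA ler_wpM2l ?powR_ge0 //.
set z := - s * h%:C.
have nz : normc z <= normc s / i%:R.
  by rewrite normcM normcN normc_real ger0_norm // ler_wpM2l ?normc_ge0.
have nz1 : normc z <= normc s.
  rewrite (le_trans nz) // ler_piMr ?normc_ge0 // invf_le1 ?ler1n // ltr0n //.
rewrite normc_distC; have := expC_taylor 1 z.
rewrite big_ord1 expr0 divr1 expr1 divr1 => /le_trans; apply.
rewrite mulrAC ler_pM ?normc_ge0 ?expR_ge0 //.
by rewrite ler_expR.
Qed.

(* By Abel summation g |-> sum g_n n^-(s + 1/2) is a bounded functional for the
   energy norm: this is the reproducing kernel at s. *)
Lemma energy_evaluation (s : R[i]) : 0 < Re s ->
  exists2 C : R, 0 < C & forall N (g : nat -> R[i]), (0 < N)%N ->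
    2 * normc (dirichlet_poly N g (s + (2^-1)%:C)) <= C * energy N g + 1.
Proof.
move=> s0; set s' := s + _.
have Res' : Re s' = Re s + 2^-1 by rewrite /s' ReD.
pose c := normc s' * expR (normc s').
have c0 : 0 <= c by rewrite mulr_ge0 ?normc_ge0 ?expR_ge0.
have vn i : (0 < i)%N -> normc (natpowC i (- s') - natpowC i.+1 (- s')) <=
    c * (i%:R `^ (- Re s') / i%:R) by move=> ?; exact: natpowC_succ_le.
clearbody c; pose al := 2 * Re s; have al0 : 0 < al by rewrite mulr_gt0.
(* The final 1 pays for the boundary term i = N of the Abel summation, the rest for the
   differences. *)
pose C := 2 * c ^+ 2 * ((2 + al) / al) + 1.
have K0 : 0 <= (2 + al) / al by rewrite divr_ge0 ?addr_ge0 ?(ltW al0).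
have C0 : 0 < C by rewrite ltr_wpDl // mulr_ge0 // mulr_ge0 ?sqr_ge0.
exists C => // N g N0.
pose S i := \sum_(1 <= j < N.+1 | (j <= i)%N) g j.
pose v i : R[i] := if (i < N)%N then natpowC i (- s') - natpowC i.+1 (- s')
  else natpowC N (- s').
have abel : dirichlet_poly N g s' = \sum_(1 <= i < N.+1) S i * v i.
  under [RHS]eq_bigr do rewrite /S mulr_suml big_mkcond.
  rewrite exchange_big; apply: eq_big_nat => j jN.
  rewrite -big_mkcond -mulr_sumr; congr (_ * _).
  by rewrite /v (sum_telescope_cut (fun i => natpowC i (- s'))).
have w0 i : (0 < i)%N -> 0 < weight R N i.
  move=> i0; rewrite /weight; case: ifP => _; rewrite ?invr_gt0 ?ltr0n // subr_gt0.
  by rewrite ltf_pV2 ?posrE ?ltr0n // ltr_nat.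
have vw i : (0 < i <= N)%N -> normc (v i) ^+ 2 / weight R N i <=
    2 * c ^+ 2 * (i%:R `^ (- al) / i%:R) + (if i == N then 1 else 0).
  move=> /andP[i0 iN]; have a0 : 0 < i%:R :> R by rewrite ltr0n.
  have a1 : 1 <= i%:R :> R by rewrite ler1n.
  have P2 : (i%:R `^ (- Re s')) ^+ 2 = i%:R `^ (- al) / i%:R :> R.
    rewrite -powR_mulrn ?powR_ge0 // -powRrM.
    have -> : - Re s' * 2%:R = - al + - 1 by rewrite Res' /al; field.
    rewrite powRD; last by rewrite (gt_eqF a0) implybT.
    by rewrite powR_inv1 // ltW.
  have P0 : 0 <= i%:R `^ (- al) / i%:R :> R by rewrite divr_ge0 ?powR_ge0.
  have [iE|iN'] := eqVneq i N.
    subst i; rewrite /v /weight ltnn invrK normc_natpowC // ReN.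
    apply: (@le_trans _ _ 1).
      by rewrite P2 divfK ?gt_eqF // powR_natN_le1 // ltW.
    by rewrite lerDr mulr_ge0 // mulr_ge0 // sqr_ge0.
  have {iN iN'} iN : (i < N)%N by rewrite ltn_neqAle iN' iN.
  rewrite addr0 /v /weight iN.
  have -> : i%:R^-1 - i.+1%:R^-1 = (i%:R * i.+1%:R)^-1 :> R.
    rewrite -natr1; move: (i%:R) a0 => a a0; field; rewrite !gt_eqF //; lra.
  rewrite invrK.
  apply: (@le_trans _ _ ((c * (i%:R `^ (- Re s') / i%:R)) ^+ 2 * (i%:R * i.+1%:R))).
    have cP : 0 <= c * (i%:R `^ (- Re s') / i%:R).
      by rewrite mulr_ge0 // divr_ge0 ?powR_ge0.
    rewrite ler_wpM2r ?mulr_ge0 // lerXn2r ?nnegrE ?normc_ge0 //.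
    exact: vn.
  rewrite exprMn expr_div_n P2 -natr1.
  move: (i%:R `^ _ / _) P0 => P P0; move: (i%:R) a0 a1 => a a0 a1.
  have -> : c ^+ 2 * (P * a ^- 2) * (a * (a + 1)) = c ^+ 2 * P * ((a + 1) / a).
    by field; rewrite gt_eqF.
  have -> : 2 * c ^+ 2 * P = c ^+ 2 * P * 2 by ring.
  rewrite ler_wpM2l ?mulr_ge0 ?sqr_ge0 // ler_pdivrMr //; lra.
have sumv : \sum_(1 <= i < N.+1) normc (v i) ^+ 2 / weight R N i <= C.
  apply: (@le_trans _ _ (\sum_(1 <= i < N.+1)
    (2 * c ^+ 2 * (i%:R `^ (- al) / i%:R) + (if i == N then 1 else 0)))).
    by rewrite !big_nat; apply: ler_sum => i iN; exact: vw.
  rewrite big_split /= -mulr_sumr lerD //.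
    by rewrite ler_wpM2l ?mulr_ge0 ?sqr_ge0 // sum_powR_le.
  rewrite big_nat_recr //= eqxx big_nat big1 ?add0r // => i /andP[_ iN].
  by rewrite ltn_eqF.
rewrite abel energyE.
(* 2 |S v| <= C w |S|^2 + |v|^2 / (C w), and the second terms add up to at most 1 by [sumv]. *)
apply: (@le_trans _ _ (\sum_(1 <= i < N.+1) (C * (weight R N i * normc (S i) ^+ 2)
    + C^-1 * (normc (v i) ^+ 2 / weight R N i)))); last first.
  rewrite big_split /= -!mulr_sumr lerD2l mulrC ler_pdivrMr // mul1r //.
apply: le_trans (ler_wpM2l _ (normc_sum _ _ _)) _ => //.
rewrite mulr_sumr !big_nat; apply: ler_sum => i /andP[i0 iN].
have := w0 i i0; rewrite normcM; move: (normc (S i)) (normc (v i)) (weight R N i).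
move=> x y w w00.
have Cw : 0 < C * w by rewrite mulr_gt0.
have := sqr_ge0 (C * w * x - y); rewrite -subr_ge0.
have -> : C * (w * x ^+ 2) + C^-1 * (y ^+ 2 / w) - 2 * (x * y) =
    (C * w * x - y) ^+ 2 / (C * w) by field; rewrite !gt_eqF.
by move=> H; rewrite divr_ge0 // ltW.
Qed.

End Evaluation.

(** * Energy of convex combinations *)

Section Mixing.
Variable R : realType.
Implicit Types (h g : nat -> R[i]).

Lemma energyB_le N h g :
  energy N (fun l => h l - g l) <= 2 * energy N h + 2 * energy N g.
Proof.
rewrite !energyE !mulr_sumr -big_split !big_nat; apply: ler_sum => i /andP[i0 _].
rewrite [2 * (_ * _)]mulrCA [X in _ <= _ + X]mulrCA -mulrDr ler_wpM2l ?weight_ge0 //.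
by rewrite sumrB (le_trans (sqr_normcD_le _ _)) // normcN.
Qed.

Lemma energy_delta N : (0 < N)%N -> energy N (fun l => (l == 1%N)%:R : R[i]) = 1.
Proof.
move=> N0; rewrite energyE -[RHS]invr1 -(weight_sum R (N := N) (k := 1)) ?N0 //.
rewrite [RHS]big_mkcond; apply: eq_big_nat => i /andP[i0 iN]; rewrite i0.
rewrite big_mkcond big_ltn // i0 eqxx big_nat big1 ?addr0; last first.
  by move=> l /andP[l1 _]; rewrite gtn_eqF //; case: ifP.
by rewrite Monoid.mulm1 normc1 expr1n mulr1.
Qed.

(* The cross term is negligible: it is small on i < X because the head of g is
   small there, and on i >= X because these i carry total weight 1 / X. *)
Lemma energy_mix N X h g (x T kappa H : R) :
  0 <= x -> x <= 1 -> 0 < T -> 0 <= kappa -> (0 < X <= N)%N ->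
  \sum_(1 <= k < N.+1) normc (h k) <= H ->
  \sum_(1 <= k < X.+1) normc (g k) <= kappa ->
  energy N (fun l => (1 - x)%:C * h l + x%:C * g l) <=
  (1 - x) ^+ 2 * energy N h + (x ^+ 2 + T^-1) * energy N g
    + 2 * (H * kappa) + T * H ^+ 2 / X%:R.
Proof.
move=> x0 x1 T0 kap0 /andP[X0 XN] Hh Hg; rewrite !energyE.
have N0 : (0 < N)%N by rewrite (leq_trans X0).
have w1 : 2 * (H * kappa) = \sum_(1 <= i < N.+1) weight R N i * (2 * (H * kappa)).
  rewrite -mulr_suml -[LHS]mul1r; congr (_ * _).
  rewrite -[LHS]invr1 -(weight_sum R (N := N) (k := 1)) ?N0 // big_mkcond.
  by apply: eq_big_nat => i /andP[-> _].
have wX : T * H ^+ 2 / X%:R = \sum_(1 <= i < N.+1) weight R N i *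
    (if (X <= i)%N then T * H ^+ 2 else 0).
  rewrite -(weight_sum R (N := N) (k := X)) ?X0 // mulr_sumr big_mkcond.
  by apply: eq_bigr => i _; case: ifP => _; rewrite ?mulr0 // mulrC.
rewrite w1 wX !mulr_sumr -!big_split !big_nat; apply: ler_sum => i /andP[i0 iN] /=.
have wi := weight_ge0 R N i0.
rewrite big_split /= -!mulr_sumr.
set Sh := \sum_(_ <= _ < _ | _) h _; set Sg := \sum_(_ <= _ < _ | _) g _.
have nSh : normc Sh <= H.
  apply: le_trans Hh; apply: le_trans (normc_sum _ _ _) _.
  by rewrite big_mkcond; apply: ler_sum => k _; case: ifP => // _; exact: normc_ge0.
have H0 : 0 <= H by rewrite (le_trans _ nSh) // normc_ge0.
have nSg : (i < X)%N -> normc Sg <= kappa.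
  move=> iX; apply: le_trans Hg; apply: le_trans (normc_sum _ _ _) _.
  rewrite (@big_cat_nat _ _ _ X.+1) //= [X in _ + X]big_nat_cond.
  rewrite [X in _ + X]big1 ?addr0 => [|k /andP[/andP[Xk _] ki]]; last first.
    by have := leq_trans (leq_trans Xk ki) (ltnW iX); rewrite ltnn.
  by rewrite big_mkcond; apply: ler_sum => k _; case: ifP => // _; exact: normc_ge0.
have tri : normc ((1 - x)%:C * Sh + x%:C * Sg) <= (1 - x) * normc Sh + x * normc Sg.
  apply: le_trans (le_normcD _ _) _.
  by rewrite !normcM !normc_real !ger0_norm // subr_ge0.
move: (weight R N i) (normc Sh) (normc Sg) (normc ((1 - x)%:C * Sh + x%:C * Sg)) wi nSh nSg tri
  (normc_ge0 Sh) (normc_ge0 Sg) (normc_ge0 ((1 - x)%:C * Sh + x%:C * Sg)).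
move=> w u v z w0 uH vk zuv u0 v0 z0.
have -> : (1 - x) ^+ 2 * (w * u ^+ 2) + (x ^+ 2 + T^-1) * (w * v ^+ 2) +
    w * (2 * (H * kappa)) + w * (if (X <= i)%N then T * H ^+ 2 else 0) =
  w * ((1 - x) ^+ 2 * u ^+ 2 + x ^+ 2 * v ^+ 2 + (v ^+ 2 / T + 2 * (H * kappa)
    + (if (X <= i)%N then T * H ^+ 2 else 0))) by ring.
rewrite ler_wpM2l // (@le_trans _ _ (((1 - x) * u + x * v) ^+ 2)) //.
  by rewrite lerXn2r ?nnegrE // addr_ge0 // mulr_ge0 // subr_ge0.
have -> : ((1 - x) * u + x * v) ^+ 2 =
  (1 - x) ^+ 2 * u ^+ 2 + x ^+ 2 * v ^+ 2 + 2 * (x * (1 - x)) * (u * v) by ring.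
rewrite lerD2l.
have uv0 : 0 <= u * v by rewrite mulr_ge0.
have xx : 2 * (x * (1 - x)) * (u * v) <= 2 * (u * v).
  rewrite ler_wpM2r // -[leRHS]mulr1 ler_wpM2l //; nra.
apply: (le_trans xx).
have vT : 0 <= v ^+ 2 / T by rewrite divr_ge0 ?sqr_ge0 // ltW.
have Hk : 0 <= H * kappa by rewrite mulr_ge0.
case: ltnP => iX.
  have : u * v <= H * kappa by rewrite ler_pM // vk.
  lra.
have : 2 * (u * v) <= v ^+ 2 / T + T * u ^+ 2.
  rewrite -subr_ge0.
  have -> : v ^+ 2 / T + T * u ^+ 2 - 2 * (u * v) = (v - T * u) ^+ 2 / T.
    by field; rewrite gt_eqF.
  by rewrite divr_ge0 ?sqr_ge0 // ltW.
have : T * u ^+ 2 <= T * H ^+ 2.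
  by rewrite ler_wpM2l ?(ltW T0) // lerXn2r ?nnegrE.
lra.
Qed.

End Mixing.

(** * The approximation criterion *)

Section Criterion.
Variables (R : realType) (m : nat) (a : nat -> R[i]) (r : R).
Hypothesis hm : (0 < m)%N.
Hypothesis ha : a 1%N != 0.

(* Twisting by j^-r moves the abscissa r to 0. *)
Let p (j : nat) : R[i] := natpowC j (- r%:C) * a j.
Let q := kappa_coef a r.
Let sq (k : nat) : R[i] := (Num.sqrt k%:R)%:C.

Let p1 : p 1%N != 0.
Proof. by rewrite /p natpowC1 mul1r. Qed.

Let sqE k : (0 < k)%N -> sq k = natpowC k (2^-1)%:C.
Proof. by move=> k0; rewrite natpowC_real // powR12_sqrt. Qed.

Let qE j : (0 < j)%N -> q j = sq j * p j.
Proof.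
move=> j0; rewrite sqE // /q /kappa_coef /p mulrA -natpowCD mulrC.
congr (_ * _); have jR : j%:R != 0 :> R by rewrite pnatr_eq0 -lt0n.
rewrite -rmorphN -rmorphD natpowC_real //= -(rmorphV (real_complex R)); last first.
  by rewrite unitfE powR_eq0 negb_and jR.
by rewrite -powRN opprB.
Qed.

Let dconv_eq0 (u b : nat -> R[i]) n l : (forall k, (n < k)%N -> b k = 0) ->
  (m * n < l)%N -> dconv m u b l = 0.
Proof.
move=> bn nl; rewrite /dconv big_nat_cond big1 // => j /andP[/andP[j0 jm] jl].
rewrite bn ?mulr0 // ltn_divRL // (leq_ltn_trans _ nl) // mulnC leq_mul2r -ltnS jm orbT //.
Qed.

Let dconvqE (y : nat -> R[i]) n : (0 < n)%N ->
  dconv m q (fun k => sq k * y k) n = sq n * dconv m p y n.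
Proof.
move=> n0; rewrite -dconv_twist //; last first.
  by move=> j k j0 k0; rewrite /sq natrM sqrtrM // rmorphM.
by apply: eq_dconv => // j /andP[j0 _]; rewrite qE.
Qed.

(** At s + 1/2 the residual takes the value 1 - q b, and q vanishes there because q_j = sqrt j p_j
    and p(s) = 0. Boundedness of the evaluation then keeps the energy away from 0. *)
Lemma energy_residual_bound (s : R[i]) :
  0 < Re s -> dirichlet_poly m p s = 0 ->
  exists2 C : R, 0 < C & forall n (b : nat -> R[i]), (forall k, (n < k)%N -> b k = 0) ->
    C^-1 <= energy (m * n.+1) (residual m a r b).
Proof.
move=> s0 ps; have [C C0 HC] := energy_evaluation s0.
(* The successor keeps N positive when n = 0. *)
exists C => // n b bn; set N := (m * n.+1)%N.
have N0 : (0 < N)%N by rewrite muln_gt0 hm.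
have bn1 k : (n.+1 < k)%N -> b k = 0 by move=> /ltnW; exact: bn.
have := HC N (residual m a r b) N0.
suff -> : dirichlet_poly N (residual m a r b) (s + (2^-1)%:C) = 1.
  by rewrite normc1 mulr1 -[leRHS]mulr1 => H; rewrite -[_^-1]mul1r ler_pdivrMr // mulrC; lra.
have -> : dirichlet_poly N (residual m a r b) (s + (2^-1)%:C) =
    1 - dirichlet_poly m q (s + (2^-1)%:C) * dirichlet_poly n.+1 b (s + (2^-1)%:C).
  rewrite dirichlet_polyM // /dirichlet_poly /residual -/N.
  under eq_bigr do rewrite mulrBl.
  rewrite sumrB; congr (_ - _).
  rewrite big_ltn // natpowC1 eqxx mulr1 big_nat big1 ?addr0 // => k /andP[k1 _].
  by rewrite gtn_eqF // mul0r.
suff -> : dirichlet_poly m q (s + (2^-1)%:C) = 0 by rewrite mul0r subr0.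
rewrite -[RHS]ps /dirichlet_poly; apply: eq_big_nat => j /andP[j0 _].
rewrite qE // sqE // opprD natpowCD.
rewrite -mulrA mulrCA [natpowC j (- s) * _]mulrC [natpowC j (2^-1)%:C * _]mulrA.
by rewrite -natpowCD subrr natpowC0 mul1r.
Qed.

Hypothesis nz : forall s : R[i], 0 < Re s -> dirichlet_poly m p s != 0.

(** With b_k = sqrt k y_k the residual is the delta at 1 minus sqrt n times the coefficients of Q D,
    so transference bounds its energy uniformly. Bounded energy and vanishing heads amount to weak
    convergence to 0. *)
Lemma good_approximants : exists2 C : R, 0 < C & forall X nu, 0 < nu ->
  exists N (b : nat -> R[i]), [/\ (X <= N)%N, forall k, (N < k)%N -> b k = 0,
    forall M, (0 < M)%N -> (m * N <= M)%N -> energy M (residual m a r b) <= C &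
    \sum_(1 <= k < X.+1) normc (residual m a r b k) <= nu].
Proof.
have [B B0 HB] := approximate_inverse hm p1 nz.
exists (2 * 1 + 2 * (2 * B ^+ 2)).
  by rewrite ltr_wpDr ?mulr_gt0 // !mulr_ge0 // sqr_ge0.
move=> X nu nu0; pose Q := \sum_(1 <= k < X.+1) Num.sqrt k%:R : R.
have Q0 : 0 <= Q by rewrite sumr_ge0 // => k _; exact: sqrtr_ge0.
have nuQ : 0 < nu / (Q + 1) by rewrite divr_gt0 // ltr_wpDl.
have [N [y [XN yN Hy Hd]]] := HB X _ nuQ.
pose b k := sq k * y k; exists N, b; split=> //.
- by move=> k /yN; rewrite /b => ->; rewrite mulr0.
- move=> M M0 NM.
  have -> : energy M (residual m a r b) =
      energy M (fun l => (l == 1%N)%:R - sq l * dconv m p y l).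
    apply: eq_big_nat => k /andP[k0 _]; apply: eq_big_nat => l /andP[l0 _].
    by rewrite /residual !dconvqE.
  apply: le_trans (energyB_le _ _ _) _; rewrite energy_delta // lerD2l ler_wpM2l //.
  apply: energy_le_sup => // t.
  rewrite (dirichlet_poly_trunc _ NM); first exact: Hy.
  by move=> k; exact: dconv_eq0.
apply: (@le_trans _ _ (\sum_(1 <= k < X.+1) Num.sqrt k%:R * (nu / (Q + 1)))).
  rewrite !big_nat; apply: ler_sum => k /andP[k0 kX].
  have -> : residual m a r b k = - (sq k * (dconv m p y k - (k == 1%N)%:R)).
    rewrite /residual dconvqE // mulrBr opprB; congr (_ - _).
    by case: eqVneq => [->|_]; rewrite ?mulr0 // /sq sqrtr1 mul1r.
  rewrite normcN normcM normc_real ger0_norm ?sqrtr_ge0 // ler_wpM2l ?sqrtr_ge0 //.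
  by rewrite Hd // k0.
rewrite -mulr_suml -/Q mulrCA ler_piMr ?(ltW nu0) // ler_pdivrMr ?ltr_wpDl //.
by rewrite mul1r lerDl.
Qed.

(** Both sides equal the same integral [sq_error]. *)
Lemma energy_residual_widen n N N' (b : nat -> R[i]) : (forall k, (n < k)%N -> b k = 0) ->
  (m * n <= N)%N -> (0 < N)%N -> (m * n <= N')%N -> (0 < N')%N ->
  energy N (residual m a r b) = energy N' (residual m a r b).
Proof.
move=> bn nN N0 nN' N'0.
by have := sq_errorE a r nN N0 bn; rewrite (sq_errorE a r nN' N'0 bn) => -[].
Qed.

Let is_energy (e : R) : Prop := exists n (b : nat -> R[i]),
  (forall k, (n < k)%N -> b k = 0) /\ e = energy (m * n.+1) (residual m a r b).

(* Mixing b with a good approximant in proportion x; the cross term vanishes in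
   the limit because the residuals of the approximants tend to 0 weakly. *)
Lemma energy_contraction : exists2 C : R, 0 < C &
  forall e x nu, is_energy e -> 0 <= x -> x <= 1 -> 0 < nu ->
    exists2 e', is_energy e' & e' <= (1 - x) ^+ 2 * e + x ^+ 2 * C + nu.
Proof.
have [C C0 HC] := good_approximants; exists C => // _ x nu [n [b [bn ->]]] x0 x1 nu0.
have nu3 : 0 < nu / 3 by rewrite divr_gt0.
pose M0 := (m * n.+1)%N; have M00 : (0 < M0)%N by rewrite muln_gt0 hm.
pose h := residual m a r b.
pose H := \sum_(1 <= k < M0.+1) normc (h k).
have H0 : 0 <= H by rewrite sumr_ge0 // => k _; exact: normc_ge0.
(* [T], [X] and [kap] are chosen in this order so that each of the three error terms of [energy_mix]
   is at most nu / 3. *)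
pose T := C / (nu / 3); have T0 : 0 < T by rewrite divr_gt0.
pose X := (Num.bound (T * H ^+ 2 / (nu / 3))).+1.
have XT : T * H ^+ 2 / X%:R <= nu / 3.
  rewrite ler_pdivrMr ?ltr0n // [leRHS]mulrC -ler_pdivrMr // ltW //.
  apply: (@lt_trans _ _ (Num.bound (T * H ^+ 2 / (nu / 3)))%:R).
    by rewrite archi_boundP // divr_ge0 ?(ltW nu3) // mulr_ge0 ?sqr_ge0 // ltW.
  by rewrite ltr_nat.
pose kap := nu / 3 / (2 * (H + 1)).
have kap0 : 0 < kap by rewrite divr_gt0 // mulr_gt0 // ltr_wpDl.
have Hkap : 2 * (H * kap) <= nu / 3.
  have -> : 2 * (H * kap) = nu / 3 * (H / (H + 1)).
    by rewrite /kap; field; rewrite gt_eqF // ltr_wpDl.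
  rewrite ler_piMr ?(ltW nu3) // ler_pdivrMr ?ltr_wpDl // mul1r lerDl //.
have [N [b' [XN b'N Eb' hb']]] := HC X kap kap0.
pose n' := maxn n N; pose b2 k := (1 - x)%:C * b k + x%:C * b' k.
have b20 k : (n' < k)%N -> b2 k = 0.
  by rewrite gtn_max => /andP[/bn nk /b'N Nk]; rewrite /b2 nk Nk !mulr0 addr0.
pose M := (m * n'.+1)%N.
exists (energy M (residual m a r b2)); first by exists n', b2; split.
have M1 : (0 < M)%N by rewrite muln_gt0 hm.
have nM : (m * n <= M)%N by rewrite leq_mul2l leqW ?orbT // leq_maxl.
have NM : (m * N <= M)%N by rewrite leq_mul2l leqW ?orbT // leq_maxr.
have M0M : (M0 <= M)%N by rewrite leq_mul2l ltnS leq_maxl orbT.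
have XM : (X <= M)%N.
  by rewrite (leq_trans XN) // (leq_trans _ NM) // leq_pmull.
have -> : energy M (residual m a r b2) = energy M (fun l => (1 - x)%:C * h l
    + x%:C * residual m a r b' l).
  have E l : residual m a r b2 l = (1 - x)%:C * h l + x%:C * residual m a r b' l.
    rewrite /h /residual !mulrBr addrACA -mulrDl -rmorphD /= subrK mul1r.
    rewrite -opprD; congr (_ - _); rewrite /dconv !mulr_sumr -big_split /=.
    by apply: eq_bigr => j _; rewrite /b2 mulrDr !(mulrCA (kappa_coef a r j)).
  by apply: eq_big_nat => k _; apply: eq_big_nat => l _; rewrite !E.
have hH : \sum_(1 <= k < M.+1) normc (h k) <= H.
  rewrite /H (@big_cat_nat _ _ _ M0.+1 1 M.+1) //= [X in _ + X]big_nat.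
  rewrite [X in _ + X]big1 ?addr0 // => k /andP[Mk _].
  rewrite /h /residual (dconv_eq0 _ bn); last first.
    by rewrite (leq_ltn_trans _ Mk) // leq_mul2l leqnSn orbT.
  by rewrite gtn_eqF ?(leq_ltn_trans M00) // subrr normc0.
have XM' : (0 < X <= M)%N by rewrite XM.
apply: le_trans (energy_mix x0 x1 T0 (ltW kap0) XM' hH hb') _.
have -> : energy M h = energy M0 h.
  by apply: (energy_residual_widen bn) => //; rewrite leq_mul2l leqnSn orbT.
have gC := Eb' M M1 NM.
have : (x ^+ 2 + T^-1) * energy M (residual m a r b') <= (x ^+ 2 + T^-1) * C.
  by rewrite ler_wpM2l // addr_ge0 ?sqr_ge0 // invr_ge0 ltW.
have : T^-1 * C = nu / 3 by rewrite /T invf_div divfK // gt_eqF.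
rewrite [(x ^+ 2 + T^-1) * C]mulrDl -/M0 -/h; lra.
Qed.

(** For the infimum d, contraction gives d <= (1 - x)^2 d + x^2 C <= (1 - x) d + x^2 C, hence d <= x
    C for all small x, and d = 0. *)
Lemma energy_arbitrarily_small eps : 0 < eps ->
  exists n (b : nat -> R[i]), (forall k, (n < k)%N -> b k = 0) /\
    energy (m * n.+1) (residual m a r b) < eps.
Proof.
move=> eps0; have [C C0 HC] := energy_contraction.
pose S : set R := [set e | is_energy e].
have S0 : S !=set0.
  by exists (energy (m * 1) (residual m a r (fun=> 0))); exists 0%N, (fun=> 0).
have lbS : lbound S 0 by move=> _ [n [b [_ ->]]]; exact: energy_ge0.
have hS : has_inf S by split => //; exists 0.
pose d := inf S.
have d0 : 0 <= d by apply: lb_le_inf.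
have key x : 0 < x -> x <= 1 -> d <= x * C.
  move=> x0 x1; have xd : x * d <= x * (x * C).
    rewrite -subr_ge0 leNgt; apply/negP => neg.
    (* A quarter of the assumed gap: near-minimality of e and the contraction each cost one nu, so
       e' <= d - 2 nu, below the infimum. *)
    pose nu := (x * d - x * (x * C)) / 4.
    have nu0 : 0 < nu by rewrite divr_gt0 //; lra.
    have [e Se ed] := inf_adherent nu0 hS.
    have [e' Se' e'e] := HC e x nu Se (ltW x0) x1 nu0.
    have de' : d <= e' by apply: ge_inf => //; exists 0.
    have : (1 - x) ^+ 2 * e <= (1 - x) ^+ 2 * (d + nu).
      by rewrite ler_wpM2l ?sqr_ge0 // ltW.
    have : (1 - x) ^+ 2 * (d + nu) <= (1 - x) * d + nu.
      rewrite mulrDr lerD //.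
        rewrite ler_wpM2r // expr2 ler_piMr ?subr_ge0 //; lra.
      by rewrite ler_piMl ?(ltW nu0) // exprn_ile1 //; lra.
    have : 4 * nu = x * d - x * (x * C) by rewrite /nu; field.
    have : (1 - x) * d = d - x * d by ring.
    have : x ^+ 2 * C = x * (x * C) by ring.
    move: (x ^+ 2 * C) (x * (x * C)) (x * d) ((1 - x) * d) ((1 - x) ^+ 2 * e)
      ((1 - x) ^+ 2 * (d + nu)) e'e de'.
    by clearbody nu d => *; lra.
  by rewrite ler_pM2l in xd.
have d_le0 : d <= 0.
  rewrite leNgt; apply/negP => dpos.
  pose x := Num.min 1 (d / (2 * C)).
  have x0 : 0 < x by rewrite lt_min ltr01 divr_gt0 // mulr_gt0.
  have := key x x0; rewrite ge_min lexx => /(_ isT).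
  have : x * C <= d / 2.
    rewrite -ler_pdivlMr // -mulrA -invfM ge_min lexx orbT //.
  lra.
have [_ [n [b [bn ->]]] eb] := inf_adherent eps0 hS.
exists n, b; split=> //; apply: lt_le_trans eb _; rewrite -/d; lra.
Qed.

End Criterion.

Theorem theorem1 (R : realType) (m : nat) (a : nat -> R[i]) (r : R)
    (hm : (0 < m)%N) (ha : a 1%N != 0) :
  (forall s : R[i], r < Re s -> dirichlet_poly m a s != 0) <->
  dist m a r n @[n --> \oo] --> (0 : R).
Proof.
have dist_ge0 n : 0 <= dist m a r n by exact: sqrtr_ge0.
split=> [nz|dist0 s rs].
  have nzp s : 0 < Re s ->
      dirichlet_poly m (fun j => natpowC j (- r%:C) * a j) s != 0.
    by move=> s0; rewrite -dirichlet_polyD nz // ReD /= ltrDl.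
  apply/cvgrPdist_lt => eps eps0.
  have eps2 : 0 < eps ^+ 2 by rewrite exprn_gt0.
  have [n0 [b [bn0 Eb]]] := energy_arbitrarily_small hm ha nzp eps2.
  exists n0 => // n /= n0n; rewrite sub0r normrN ger0_norm //.
  have bn k : (n < k)%N -> b k = 0 by move=> nk; rewrite bn0 // (leq_ltn_trans n0n).
  have mn1 j : (0 < m * j.+1)%N by rewrite muln_gt0 hm.
  have mn2 j k : (j <= k)%N -> (m * j <= m * k.+1)%N.
    by move=> jk; rewrite leq_mul2l leqW ?orbT.
  (* An approximant of length n0 padded with zeros keeps its error at every length n >= n0. *)
  have En : sq_error m a r n b = (energy (m * n0.+1) (residual m a r b))%:E.
    rewrite (sq_errorE a r (mn2 n n (leqnn n)) (mn1 n) bn); congr EFin.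
    by apply: (energy_residual_widen a r bn0); rewrite ?mn1 ?mn2.
  rewrite -(ltr_pXn2r (ltn0Sn 1)) ?nnegrE ?(ltW eps0) // -lte_fin dist_sqr.
  apply: (@le_lt_trans _ _ (sq_error m a r n b)).
    by apply: ereal_inf_lbound; exists b.
  by rewrite En lte_fin.
apply/eqP => as0; pose s1 := s - r%:C.
have s10 : 0 < Re s1 by rewrite /s1 ReB /= subr_gt0.
have ps : dirichlet_poly m (fun j => natpowC j (- r%:C) * a j) s1 = 0.
  by rewrite -dirichlet_polyD /s1 addrC subrK.
have [C C0 HC] := energy_residual_bound hm s10 ps.
have dist_lb n : C^-1 <= dist m a r n ^+ 2.
  rewrite -lee_fin dist_sqr; apply: le_ereal_inf_tmp => _ [b _ <-].
  (* The error only reads b_1, ..., b_n; cutting off the rest gives the finite support on which the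
     integral becomes an energy. *)
  pose b' k := if (k <= n)%N then b k else 0.
  have b'n k : (n < k)%N -> b' k = 0 by rewrite /b' ltnNge => /negbTE ->.
  have -> : sq_error m a r n b = sq_error m a r n b'.
    apply: eq_integral => x _; congr ((normc (_ - _) ^+ 2)%:E).
    by apply: eq_big_nat => k /andP[_ kn]; rewrite /b' -ltnS kn.
  rewrite (sq_errorE a r (N := m * n.+1) _ _ b'n) ?lee_fin ?HC //.
    by rewrite leq_mul2l leqnSn orbT.
  by rewrite muln_gt0 hm.
have sC : 0 < Num.sqrt C^-1 by rewrite sqrtr_gt0 invr_gt0.
move/cvgrPdist_lt : dist0 => /(_ _ sC) [N _ /(_ N (leqnn N))] /=.
rewrite sub0r normrN ger0_norm // ltNge => /negP; apply.
by rewrite -[leRHS]ger0_norm // -sqrtr_sqr ler_wsqrtr.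
Qed.
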